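(* Let $K$ be a field and let $G$ be a finite simple gap-free graph without isolated vertices, with vertex set $\{1,\ldots,n\}$ and with $m$ edges. Let $\sigma$ be an arbitrary graded reverse lexicographic order on $K[x_1,\ldots,x_n]$ (i.e. with respect to an arbitrary ordering of the variables). Order the edges of $G$ by declaring $\{i_1,i_2\}\preceq\{j_1,j_2\}$ if and only if $x_{i_1}x_{i_2}\preceq_\sigma x_{j_1}x_{j_2}$, and name the edges $e_1,\ldots,e_m$ so that $e_1\succ e_2\succ\cdots\succ e_m$. Let $I_G\subseteq K[y_1,\ldots,y_m]$ be the toric ideal of $G$, where $y_i$ corresponds to $e_i$, and let $\tau$ be the lexicographic order on $K[y_1,\ldots,y_m]$ with $y_1\succ_\tau y_2\succ_\tau\cdots\succ_\tau y_m$. Then the reduced Gröbner basis of $I_G$ with respect to $\tau$ consists of circuits of $I_G$, and hence $I_G$ is generated by circuits.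
   Context: For an edge $e=\{i,j\}$ of $G$, the edge monomial is $M_e=x_ix_j\in K[x_1,\ldots,x_n]$. The toric ideal $I_G$ is the kernel of the surjective $K$-algebra homomorphism $K[y_1,\ldots,y_m]\to K[M_{e_1},\ldots,M_{e_m}]$, $y_i\mapsto M_{e_i}$. A graph $G$ is gap-free if for any two edges $\{v_1,v_2\},\{w_1,w_2\}\in E(G)$ with $v_1,v_2,w_1,w_2$ all distinct there exist $i,j\in\{1,2\}$ such that $\{v_i,w_j\}\in E(G)$. The support of a nonzero binomial $b=u-v\in I_G$ ($u,v$ monomials) is the set $\operatorname{supp}(b)$ of variables appearing in $u$ or in $v$. A binomial $b\in I_G$ is a circuit if it is irreducible and has minimal support, i.e. there is no nonzero binomial $b'\in I_G$ with $\operatorname{supp}(b')\subsetneq\operatorname{supp}(b)$. A Gröbner basis is reduced if its elements are monic, its leading terms minimally generate the initial ideal, and no trailing term of its elements lies in the initial ideal. *)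

(* Defs.v *)
From HB Require Import structures.
From mathcomp Require Import all_boot all_order all_fingroup all_algebra.
From mathcomp Require Import mpoly.

Set Implicit Arguments.
Unset Strict Implicit.
Unset Printing Implicit Defensive.

Import GRing.Theory.
Local Open Scope ring_scope.

(* A simple graph on {0, .., n-1} is a symmetric irreflexive relation. *)
Section Graphs.

Variables (n : nat) (adj : rel 'I_n).

Definition no_isolated_vertex : Prop := forall i, exists j, adj i j.

Definition gap_free : Prop :=
  forall v1 v2 w1 w2,
    adj v1 v2 -> adj w1 w2 -> uniq [:: v1; v2; w1; w2] ->
    [|| adj v1 w1, adj v1 w2, adj v2 w1 | adj v2 w2].

Definition edges : {set {set 'I_n}} :=
  [set e : {set 'I_n} | [exists i, exists j, adj i j && (e == [set i; j])]].

End Graphs.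

Definition edge_mnm (n : nat) (e : {set 'I_n}) : 'X_{1..n} :=
  (\sum_(i in e) U_(i))%MM.

(* The strict graded reverse lexicographic order in which the variables are
   ranked x_(s 0) > x_(s 1) > .. > x_(s (n-1)): among monomials of the same
   degree, the smaller one has the larger exponent at the lowest-ranked variable
   where they differ.  The default order of mpoly on 'X_{1..n} is not this one:
   it breaks ties lexicographically. *)
Definition grevlex_lt (n : nat) (s : 'S_n) (u v : 'X_{1..n}) : bool :=
  (mdeg u < mdeg v)%N ||
  (mdeg u == mdeg v) &&
    [exists k : 'I_n, (v (s k) < u (s k))%N &&
       [forall l : 'I_n, (k < l)%N ==> (u (s l) == v (s l))]].

(* The strict lexicographic order with y_0 > y_1 > .. > y_(m-1). *)
Definition lex_lt (m : nat) (u v : 'X_{1..m}) : bool :=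
  [exists k : 'I_m, (u k < v k)%N &&
     [forall l : 'I_m, (l < k)%N ==> (u l == v l)]].

(* e_0, .., e_(m-1) lists the edges without repetition, from the largest edge
   monomial to the smallest. *)
Definition decreasing_edge_list (n m : nat) (adj : rel 'I_n) (s : 'S_n)
    (e : 'I_m -> {set 'I_n}) : Prop :=
  [/\ injective e,
      forall A, (A \in edges adj) = (A \in codom e)
    & forall k l : 'I_m, (k < l)%N ->
        grevlex_lt s (edge_mnm (e l)) (edge_mnm (e k))].

Definition ideal_span (R : comNzRingType) (S : R -> Prop) (f : R) : Prop :=
  exists2 cs : seq (R * R),
    forall c, c \in cs -> S c.2 & f = \sum_(c <- cs) c.1 * c.2.

Definition irreducible_elt (R : idomainType) (p : R) : Prop :=
  [/\ p != 0, p \isn't a GRing.unit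
    & forall a b, p = a * b -> (a \is a GRing.unit) \/ (b \is a GRing.unit)].

(* Leading monomials and Groebner bases with respect to a strict monomial
   order lt.  Coefficients lie in a field, so leading terms and leading
   monomials generate the same ideals. *)
Section Groebner.

Variables (K : fieldType) (m : nat) (lt : rel 'X_{1..m}).
Implicit Types (f g p : {mpoly K[m]}) (u : 'X_{1..m}).

Definition is_lead p u : bool :=
  (u \in msupp p) && all (fun v => (v == u) || lt v u) (msupp p).

Definition lead_ideal (S : {mpoly K[m]} -> Prop) : {mpoly K[m]} -> Prop :=
  ideal_span (fun q => exists f u, [/\ S f, is_lead f u & q = 'X_[u]]).

Definition groebner_basis (I : {mpoly K[m]} -> Prop) (gs : seq {mpoly K[m]}) :=
  (forall g, g \in gs -> I g) /\
  (forall f, lead_ideal I f <-> lead_ideal (fun g => g \in gs) f).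

Definition reduced_groebner_basis
    (I : {mpoly K[m]} -> Prop) (gs : seq {mpoly K[m]}) : Prop :=
  [/\ groebner_basis I gs,
      forall g, g \in gs -> exists2 u, is_lead g u & g@_u = 1,
      forall g, g \in gs ->
        ~ (forall f, lead_ideal I f <->
                     lead_ideal (fun h => (h \in gs) && (h != g)) f)
    & forall g u, g \in gs -> u \in msupp g -> ~~ is_lead g u ->
        ~ lead_ideal I 'X_[u]].

End Groebner.

Section ToricIdeals.

Variable K : fieldType.

(* The kernel of K[y] -> K[x], y_k |-> M_(e_k); corestricting to the edge ring
   does not change it. *)
Definition toric_ideal (n m : nat) (e : 'I_m -> {set 'I_n})
    (f : {mpoly K[m]}) : Prop :=
  f \mPo [tuple 'X_[K, edge_mnm (e k)] | k < m] = 0.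

Definition nonzero_binomial (m : nat) (b : {mpoly K[m]}) : Prop :=
  exists u v : 'X_{1..m}, u != v /\ b = 'X_[u] - 'X_[v].

Definition supp_vars (m : nat) (b : {mpoly K[m]}) : {set 'I_m} :=
  [set i | has (fun u : 'X_{1..m} => u i != 0%N) (msupp b)].

Definition circuit (m : nat) (I : {mpoly K[m]} -> Prop) (b : {mpoly K[m]}) :=
  [/\ I b, nonzero_binomial b, irreducible_elt b
    & ~ exists b', [/\ I b', nonzero_binomial b'
                     & supp_vars b' \proper supp_vars b]].

End ToricIdeals.

(* Main.v *)
Require Import Defs.
From mathcomp Require Import all_boot all_order all_fingroup all_algebra.
From mathcomp Require Import zify.
From mathcomp Require Import mpoly.

(* The toric ideal is spanned by the differences of monomials with the same
   vertex degrees, and its reduced Groebner basis consists of the binomials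
   y^u - y^v with u a minimal nonstandard monomial and v the least monomial with
   the degrees of u.  By minimality u and v are coprime, and u - v is carried by
   one closed alternating walk through f, the largest edge occurring in u and v;
   the edges of u and of v alternate along it.

   A chord of the walk that is smaller than f and closes an even alternating
   subwalk through f would make a proper divisor of u nonstandard, so there is no
   such chord.  Let x_b be the smaller variable of f.  All edges of the walk are at most
   f, so every closed odd segment avoiding b has an edge whose two variables are
   smaller than x_b, and any edge of the graph at its ends is smaller than f.
   Gap-freeness therefore supplies forbidden chords between disjoint odd
   segments, and between f and an inner one of two nested odd segments.  What
   survives is an even cycle, two odd cycles sharing a vertex, or two odd cycles
   joined by a doubled edge: in each case the kernel of the incidence matrix
   restricted to the walk is a line, and f occurs with exponent 1. *)

Set Implicit Arguments.
Unset Strict Implicit.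
Unset Printing Implicit Defensive.

Import GRing.Theory Order.TTheory.
Local Open Scope nat_scope.

(** * Standard monomials of the fibers *)

(** The order [<] compares degrees first and breaks ties lexicographically. The fibers of [vdeg] are
    homogeneous, so inside a fiber [lex_lt] can be traded for this well-founded order. *)
Lemma lex_lt_ltmc m (u v : 'X_{1..m}) :
  mdeg u = mdeg v -> lex_lt u v = (u < v)%O.
Proof.
move=> uv; apply/idP/(ltmcP uv) => [|[k uv_lt uv_k]].
  case/existsP=> k /andP[uv_k /forallP uv_lt]; exists k => // l lt_lk.
  by apply/eqP/(implyP (uv_lt l)).
apply/existsP; exists k; rewrite uv_k; apply/forallP=> l.
by apply/implyP=> /uv_lt ->.
Qed.

Section Fibers.

Variables (n m : nat) (e : 'I_m -> {set 'I_n}).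
Hypothesis e2 : forall k, #|e k| = 2.
Implicit Types (u v w : 'X_{1..m}).

(** The exponent of the image of y^u in K[x]. *)
Definition vdeg u : 'X_{1..n} := [multinom \sum_k (x \in e k) * u k | x < n].

Lemma vdegE u x : vdeg u x = \sum_k (x \in e k) * u k.
Proof. by rewrite mnmE. Qed.

Lemma vdeg0 : vdeg 0 = 0%MM.
Proof. by apply/mnmP=> x; rewrite vdegE mnm0E big1 // => k _; rewrite mnm0E muln0. Qed.

Lemma vdegD u v : vdeg (u + v) = (vdeg u + vdeg v)%MM.
Proof.
apply/mnmP=> x; rewrite mnmDE !vdegE -big_split.
by apply: eq_bigr=> k _; rewrite mnmDE mulnDr.
Qed.

Lemma vdegB u v : (v <= u)%MM -> vdeg (u - v) = (vdeg u - vdeg v)%MM.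
Proof. by move=> vu; rewrite -{2}(submK vu) vdegD addmK. Qed.

Lemma vdegU k x : vdeg U_(k) x = (x \in e k).
Proof.
rewrite vdegE (bigD1 k) //= mnm1E eqxx muln1 big1 ?addn0 // => l nlk.
by rewrite mnm1E eq_sym (negPf nlk) muln0.
Qed.

Lemma mdeg_vdeg u : mdeg (vdeg u) = 2 * mdeg u.
Proof.
rewrite !mdegE; under eq_bigr do rewrite vdegE.
rewrite exchange_big big_distrr; apply: eq_bigr => k _ /=.
by rewrite -big_distrl -big_mkcond sum1_card e2.
Qed.

Lemma eq_vdeg_mdeg u v : vdeg u = vdeg v -> mdeg u = mdeg v.
Proof.
move=> uv; apply/eqP; rewrite -(eqn_pmul2l (isT : 0 < 2)).
by rewrite -!mdeg_vdeg uv.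
Qed.

(** These turn out to be the monomials of the initial ideal. The degree bound makes the predicate
    boolean and excludes nothing, since [vdeg] determines the degree. *)
Definition nonstd u : bool :=
  [exists v : 'X_{1..m < (mdeg u).+1}, (vdeg v == vdeg u) && (bmnm v < u)%O].

Lemma nonstdP u : reflect (exists2 v, vdeg v = vdeg u & (v < u)%O) (nonstd u).
Proof.
apply: (iffP existsP) => [[v /andP[/eqP vu lt_vu]]|[v vu lt_vu]].
  by exists v.
have vb : mdeg v < (mdeg u).+1 by rewrite (eq_vdeg_mdeg vu).
by exists (BMultinom vb); rewrite /= vu eqxx.
Qed.

Lemma nonstd_le u v : (u <= v)%MM -> nonstd u -> nonstd v.
Proof.
move=> uv /nonstdP[w wu lt_wu]; apply/nonstdP; exists (v - u + w)%MM.
  by rewrite vdegD wu -vdegD submK.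
by rewrite -{2}(submK uv) ltmc_add2r.
Qed.

Lemma std_inj u v : vdeg u = vdeg v -> ~~ nonstd u -> ~~ nonstd v -> u = v.
Proof.
move=> uv su sv; apply/eqP; apply: contraNT su => nuv.
have [lt_uv|lt_vu|/eqP] := ltgtP u v; last by rewrite (negPf nuv).
  by case/negP: sv; apply/nonstdP; exists u.
by apply/nonstdP; exists v.
Qed.

Lemma exists_std u : exists2 v, vdeg v = vdeg u & ~~ nonstd v.
Proof.
elim/(well_founded_ind (@ltom_wf m)): u => u IHu.
have [/nonstdP[v vu lt_vu]|su] := boolP (nonstd u); last by exists u.
by have [w wv sw] := IHu v lt_vu; exists w; rewrite ?wv.
Qed.

(** The default [u] is never returned, because [exists_std] provides a candidate. *)
Definition nform u : 'X_{1..m} :=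
  if [pick v : 'X_{1..m < (mdeg u).+1} | (vdeg v == vdeg u) && ~~ nonstd v]
  is Some v then v else u.

Lemma nformP u : vdeg (nform u) = vdeg u /\ ~~ nonstd (nform u).
Proof.
rewrite /nform; case: pickP => [v /andP[/eqP] //|nov].
have [v vu sv] := exists_std u.
have vb : mdeg v < (mdeg u).+1 by rewrite (eq_vdeg_mdeg vu).
by have := nov (BMultinom vb); rewrite /= vu eqxx sv.
Qed.

Lemma vdeg_nform u : vdeg (nform u) = vdeg u.
Proof. by case: (nformP u). Qed.

Lemma nform_std u : ~~ nonstd (nform u).
Proof. by case: (nformP u). Qed.

Lemma eq_nform u v : vdeg u = vdeg v -> nform u = nform v.
Proof. by move=> uv; apply: std_inj; rewrite ?vdeg_nform ?nform_std. Qed.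

Lemma nform_lt u : nonstd u -> (nform u < u)%O.
Proof.
move=> nu; have := nform_std u; case: (ltgtP (nform u) u) => //; last by move=> ->; rewrite nu.
by move=> lt_u /negP[]; apply/nonstdP; exists u; rewrite ?vdeg_nform.
Qed.

(** Dividing by single variables is enough of a test, since every multiple of a nonstandard monomial
    is nonstandard. *)
Definition min_nonstd u := nonstd u && [forall k, (0 < u k) ==> ~~ nonstd (u - U_(k))].

Lemma min_nonstdP u :
  reflect (nonstd u /\ forall v, (v <= u)%MM -> v != u -> ~~ nonstd v) (min_nonstd u).
Proof.
apply: (iffP andP) => -[nu min_u]; split=> //; last first.
  apply/forallP=> k; apply/implyP=> uk; apply: min_u; first exact: lem_subr.
  by apply/eqP=> /mnmP/(_ k); rewrite mnmBE mnm1E eqxx; lia.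
move=> v vu nvu.
have [k lt_k] : exists k, v k < u k.
  apply/existsP; apply: contraNT nvu; rewrite negb_exists => /forallP ge_u.
  by apply/eqP/mnmP=> k; apply/eqP; rewrite eqn_leq (mnm_lepP vu) leqNgt ge_u.
apply: contra (implyP (forallP min_u k) (leq_ltn_trans (leq0n _) lt_k)).
apply: nonstd_le; apply/mnm_lepP=> l; rewrite mnmBE mnm1E.
by have := mnm_lepP vu l; case: eqP => [<-|]; lia.
Qed.

Lemma exists_min_nonstd u : nonstd u -> exists2 v, (v <= u)%MM & min_nonstd v.
Proof.
elim: {u}(mdeg u) {-2}u (leqnn (mdeg u)) => [|d IHd] u du nu.
all: have [mu|] := boolP (min_nonstd u); first by exists u; rewrite ?lepm_refl.
all: rewrite /min_nonstd nu negb_forall /= => /existsP[k].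
all: rewrite negb_imply negbK => /andP[uk nuk].
  by move: du; rewrite leqn0 mdeg_eq0 => /eqP u0; rewrite u0 mnm0E in uk.
have [|v vu mv] := IHd _ _ nuk.
  have : (U_(k) <= u)%MM by rewrite lep1mP -lt0n.
  by move/submK/(congr1 (@mdeg m)); rewrite mdegD mdeg1; lia.
by exists v => //; apply: (lepm_trans vu); apply: lem_subr.
Qed.

(** A common variable could be cancelled from both monomials, leaving a proper divisor of [u] that
    is still nonstandard. *)
Lemma min_nonstd_coprime u v :
  min_nonstd u -> vdeg v = vdeg u -> (v < u)%O -> forall k, u k = 0 \/ v k = 0.
Proof.
move=> /min_nonstdP[_ min_u] vu lt_vu k.
have [|uk] := posnP (u k); first by left.
have [|vk] := posnP (v k); first by right.
have leu : (U_(k) <= u)%MM by rewrite lep1mP -lt0n.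
have lev : (U_(k) <= v)%MM by rewrite lep1mP -lt0n.
have /negP[] : ~~ nonstd (u - U_(k))%MM.
  apply: min_u; first exact: lem_subr.
  by apply/eqP=> /mnmP/(_ k); rewrite mnmBE mnm1E eqxx; lia.
apply/nonstdP; exists (v - U_(k))%MM; first by rewrite !vdegB // vu.
by rewrite -(ltmc_add2l _ _ U_(k)) !submK.
Qed.

End Fibers.

(** * Kernel vectors of the incidence matrix carried by a walk *)

Section Steps.

Variable T : eqType.
Implicit Types (w : seq T) (p : T * T).

Definition steps w := zip w (behead w).

Lemma steps_cons x y w : steps [:: x, y & w] = (x, y) :: steps (y :: w).
Proof. by []. Qed.

Lemma steps_cat w1 x w2 : steps (w1 ++ x :: w2) = steps (rcons w1 x) ++ steps (x :: w2).
Proof.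
elim: w1 => // y w1 IHw; case: w1 IHw => // z w1 IHw.
by rewrite !cat_cons steps_cons -cat_cons IHw.
Qed.

Lemma mem_steps p w : p \in steps w -> p.1 \in w /\ p.2 \in w.
Proof.
elim: w => // x w IHw; case: w IHw => // y w IHw.
rewrite steps_cons inE => /orP[/eqP->|/IHw[p1 p2]].
  by rewrite !inE !eqxx orbT.
by move: p1 p2; rewrite !inE => -> ->; rewrite !orbT.
Qed.

Lemma mem_steps_rev p w : p \in steps w -> (p.2, p.1) \in steps (rev w).
Proof.
elim: w => // x w IHw; case: w IHw => // y w IHw.
rewrite steps_cons rev_cons rev_cons -cats1 cat_rcons steps_cat mem_cat -rev_cons.
by rewrite inE => /orP[/eqP->|/IHw->]; rewrite ?inE ?eqxx ?orbT.
Qed.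

Lemma index_steps p w : uniq w -> p \in steps w -> index p.2 w = (index p.1 w).+1.
Proof.
elim: w => // x w IHw; case: w IHw => // y w IHw /andP[x_w uniq_w].
rewrite steps_cons inE => /orP[/eqP->|p_w].
  by move: x_w; rewrite inE negb_or /= eqxx => /andP[/negPf-> _]; rewrite eqxx.
have nx q : q \in y :: w -> (x == q) = false.
  by move=> q_w; apply/negbTE; apply: contraNneq x_w => ->.
have [p1 p2] := mem_steps p_w.
have indexE q : q \in y :: w -> index q [:: x, y & w] = (index q (y :: w)).+1.
  by move=> q_w; rewrite -[LHS]/(if x == q then 0 else _) nx.
by rewrite !indexE // (IHw uniq_w p_w).
Qed.

End Steps.

Section Kernel.

Variables (n m : nat) (e : 'I_m -> {set 'I_n}).
Hypothesis e2 : forall k, #|e k| = 2.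
Hypothesis e_inj : injective e.

Variable c : 'I_m -> int.
Hypothesis c_ker : forall x, (\sum_k c k *+ (x \in e k) = 0)%R.

Definition carried w := forall k, c k != 0%R ->
  exists2 p, p \in steps w & e k = [set p.1; p.2].

Lemma carried_rev w : carried w -> carried (rev w).
Proof.
move=> cw k /cw[p p_w ek]; exists (p.2, p.1); first exact: mem_steps_rev.
by rewrite ek setUC.
Qed.

(** As [x] does not recur, only the first edge of the walk can contribute to the equation at [x],
    which therefore kills its coefficient. *)
Lemma carried_peel1 x w : x \notin w -> carried (x :: w) -> carried w.
Proof.
move=> x_w cw k ck; have [p] := cw k ck; case: w x_w cw => // y w x_w cw.
rewrite steps_cons inE => /orP[/eqP-> /= ek|]; last by exists p.
case/eqP: ck; have := c_ker x; rewrite (bigD1 k) //= ek !inE eqxx mulr1n big1 ?addr0 //.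
move=> l nlk; have [xl|] := boolP (x \in e l); last by rewrite mulr0n.
have [->|/cw[q]] := eqVneq (c l) 0%R; first by rewrite mul0rn.
rewrite steps_cons inE => /orP[/eqP-> /= el|/mem_steps[q1 q2] el].
  by case/eqP: nlk; apply: e_inj; rewrite el ek.
by move: xl; rewrite el => /set2P[] xq; rewrite xq ?q1 ?q2 in x_w.
Qed.

Lemma carried_peel w1 w2 :
  uniq w1 -> ~~ has (mem w1) w2 -> carried (w1 ++ w2) -> carried w2.
Proof.
elim: w1 => //= x w1 IHw /andP[x_w1 uniq_w1] no_w12 cw; apply: IHw => //.
  apply: contra no_w12 => /hasP[z z_w2 z_w1]; apply/hasP; exists z => //.
  by rewrite /= in_cons [z \in w1]z_w1 orbT.
apply: carried_peel1 cw; rewrite mem_cat negb_or x_w1.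
by apply: contra no_w12 => x_w2; apply/hasP; exists x; rewrite //= inE eqxx.
Qed.

Lemma carried_uniq w k : uniq w -> carried w -> c k = 0%R.
Proof.
move=> uniq_w; rewrite -[w]cats0 => cw; apply/eqP; apply: contraT => ck.
by have [|p] := carried_peel uniq_w _ cw ck.
Qed.

(* Weighting the vertex equations by alternating signs along the cycle isolates
   twice the value at its first edge. *)
Lemma carried_odd_cycle y t k : uniq (y :: t) -> ~~ odd (size t) ->
  carried (y :: rcons t y) -> c k = 0%R.
Proof.
move=> uniq_yt even_t cw.
have uniq_ty : uniq (rcons t y) by rewrite rcons_uniq.
(* Indices start at the vertex after [y], so [y] comes last, at the even index [size t]. The first
   edge then joins two vertices of sign +1, and every later edge joins opposite signs. *)
pose lam z : int := ((-1) ^+ index z (rcons t y))%R.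
have sum0 : (\sum_l c l * \sum_(x in e l) lam x = 0)%R.
  transitivity (\sum_x lam x * \sum_l c l *+ (x \in e l))%R; last first.
    by rewrite big1 // => x _; rewrite c_ker mulr0.
  under eq_bigr do rewrite big_distrr big_mkcond.
  rewrite exchange_big; apply: eq_bigr => x _; rewrite big_distrr.
  by apply: eq_bigr => l _ /=; case: (x \in e l); rewrite ?mulr1n ?mulr0n ?mulr0 1?mulrC.
have sum2 l p : e l = [set p.1; p.2] -> (\sum_(x in e l) lam x = lam p.1 + lam p.2)%R.
  move=> el; have := e2 l; rewrite el cards2; case: eqP => // /eqP np _.
  by rewrite big_setU1 ?inE //= big_set1.
(* Once the first edge is excluded, [c] is carried by the path [rcons t y], whose vertices are
   distinct. *)
apply: (carried_uniq _ uniq_ty) => l cl; have [p] := cw l cl.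
have [z [r def_ty]] : exists z r, rcons t y = z :: r.
  by case: (t) => [|z r]; [exists y, [::] | exists z, (rcons r y)].
rewrite def_ty steps_cons inE -def_ty => /orP[/eqP-> /= el|]; last by exists p.
have lam_y : lam y = 1%R.
  rewrite /lam -cats1 index_cat; have /andP[/negPf-> _] := uniq_yt.
  by rewrite /= eqxx addn0 -signr_odd (negPf even_t).
have lam_z : lam z = 1%R by rewrite /lam def_ty /= eqxx.
case/eqP: cl; move: sum0; rewrite (bigD1 l) //= (sum2 l (y, z)) // lam_y lam_z big1 ?addr0.
  by lia.
move=> l' nl'; have [->|/cw[q]] := eqVneq (c l') 0%R; first by rewrite mul0r.
rewrite def_ty steps_cons inE -def_ty => /orP[/eqP-> /= el'|q_w el'].
  by case/eqP: nl'; apply: e_inj; rewrite el el'.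
by rewrite (sum2 _ _ el') /lam (index_steps uniq_ty q_w) exprS mulN1r addrN mulr0.
Qed.

End Kernel.

(** * Closed alternating walks *)

Lemma sorted_cat_cons (T : Type) (r : rel T) (s1 s2 : seq T) (x : T) :
  sorted r (s1 ++ x :: s2) = sorted r (rcons s1 x) && sorted r (x :: s2).
Proof.
by case: s1 => [|y s1] //=; rewrite cat_path rcons_path /= andbA.
Qed.

Lemma sorted_cat_cons2 (T : Type) (r : rel T) (s1 s2 s3 : seq T) (x y : T) :
  sorted r (s1 ++ x :: s2 ++ y :: s3) =
    [&& sorted r (rcons s1 x), sorted r (x :: rcons s2 y) & sorted r (y :: s3)].
Proof. by rewrite sorted_cat_cons -cat_cons sorted_cat_cons. Qed.

Lemma dup_split (T : eqType) (w : seq T) :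
  ~~ uniq w -> exists s1 x s2 s3, w = s1 ++ x :: s2 ++ x :: s3.
Proof.
elim: w => //= x w IHw; rewrite negb_and negbK => /orP[xw|/IHw[s1 [y [s2 [s3 ->]]]]].
  by case/splitPr: xw => s2 s3; exists [::], x, s2, s3.
by exists (x :: s1), y, s2, s3.
Qed.

Lemma count_split (T : eqType) (z : T) k w :
  k < count_mem z w -> exists s1 s2, w = s1 ++ z :: s2 /\ k <= count_mem z s2.
Proof.
elim: w => //= x w IHw; have [->|nxz] := eqVneq x z; first by exists [::], w.
by rewrite add0n => /IHw[s1 [s2 [-> le_k]]]; exists (x :: s1), s2.
Qed.

Lemma alternating_last (T : Type) (P : pred T) x w :
  path (fun y z => P y != P z) x w -> P (last x w) = P x (+) odd (size w).
Proof.
elim: w x => [|y w IHw] x /=; first by rewrite addbF.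
by case/andP=> nP /IHw ->; case: (P x) (P y) (odd _) nP => [] [] [].
Qed.

Lemma path_break (T : Type) (r : rel T) x w : ~~ path r x w ->
  exists t1 y z t2, x :: w = t1 ++ [:: y, z & t2] /\ ~~ r y z.
Proof.
elim: w x => //= y w IHw x; case: (boolP (r x y)) => [_|nxy _]; last by exists [::], x, y, w.
by case/IHw=> t1 [z [z' [t2 [-> nz]]]]; exists (x :: t1), z, z', t2.
Qed.

(** * Edges ordered by their monomials, and alternating products along walks *)

Section Edges.

Variables (n m : nat) (adj : rel 'I_n) (s : 'S_n) (e : 'I_m -> {set 'I_n}).
Hypothesis adj_sym : ssrbool.symmetric adj.
Hypothesis adj_irr : irreflexive adj.
Hypothesis e_dec : decreasing_edge_list adj s e.

Lemma edge_inj : injective e. Proof. by case: e_dec. Qed.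

Lemma adj_neq x y : adj x y -> x != y.
Proof. by apply: contraTneq => ->; rewrite adj_irr. Qed.

Lemma adj_edge x y : adj x y -> exists k, e k = [set x; y].
Proof.
move=> xy; case: e_dec => _ /(_ [set x; y]) eE _.
have /codomP[k ->] : [set x; y] \in codom e; last by exists k.
rewrite -eE inE; apply/existsP; exists x; apply/existsP; exists y.
by rewrite xy eqxx.
Qed.

Lemma edge_adj k : exists x y, adj x y /\ e k = [set x; y].
Proof.
case: e_dec => _ /(_ (e k)); rewrite codom_f inE => /existsP[x /existsP[y /andP[xy /eqP ->]]] _.
by exists x, y.
Qed.

Lemma card_edge k : #|e k| = 2.
Proof. by have [x [y [/adj_neq xy ->]]] := edge_adj k; rewrite cards2 xy. Qed.

(* Rank 0 is the largest variable: greater ranks make smaller edges. *)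
Definition vrank (x : 'I_n) : 'I_n := (s^-1)%g x.

Lemma edge_mnmE (A : {set 'I_n}) x : edge_mnm A x = (x \in A).
Proof.
rewrite /edge_mnm mnm_sumE; under eq_bigr do rewrite mnm1E.
have [xA|xA] := boolP (x \in A).
  by rewrite (bigD1 x) //= eqxx big1 ?addn0 // => i /andP[_ /negPf->].
by rewrite big1 // => i iA; case: eqP => // ix; rewrite -ix iA in xA.
Qed.

(** Edge monomials all have degree 2, so the graded reverse lexicographic order looks at the
    lowest-ranked variables first. The order on the vertex variables enters the proof only here. *)
Lemma lt_edge (k l : 'I_m) (d : 'I_n) :
  d \in e l -> (forall c, c \in e k -> vrank c < vrank d) -> k < l.
Proof.
move=> dl kd; rewrite ltnNge leq_eqVlt; apply/negP=> /orP[/eqP/val_inj lk|lt_lk].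
  by have := kd d; rewrite -lk dl ltnn => /(_ isT).
case: e_dec => _ _ /(_ _ _ lt_lk).
have degE A : mdeg (edge_mnm A : 'X_{1..n}) = #|A|.
  by rewrite mdegE; under eq_bigr do rewrite edge_mnmE; rewrite -big_mkcond sum1_card.
rewrite /grevlex_lt !degE !card_edge ltnn eqxx /= => /existsP[j /andP[]].
rewrite !edge_mnmE => jkl /forallP eq_j.
have jk : s j \in e k by case: (s j \in e k) jkl => //; case: (_ \in _).
have := implyP (eq_j (vrank d)); rewrite /vrank permKV !edge_mnmE dl.
have := kd _ jk; rewrite /vrank permK => lt_jd /(_ lt_jd).
by case: (boolP (d \in e k)) => // /kd; rewrite ltnn.
Qed.

(** The sum has at most one term, and is 0 when [x] and [y] are not adjacent; no edge index has to
    be chosen. *)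
Definition emon (x y : 'I_n) : 'X_{1..m} := (\sum_(k | e k == [set x; y]) U_(k))%MM.

Lemma emonE k x y : e k = [set x; y] -> emon x y = U_(k)%MM.
Proof. by move=> kxy; apply: big_pred1 => l; rewrite -kxy (inj_eq edge_inj). Qed.

Lemma emonC x y : emon x y = emon y x.
Proof. by rewrite /emon setUC. Qed.

Lemma vdeg_emon x y z : adj x y -> vdeg e (emon x y) z = (x == z) + (y == z).
Proof.
move=> xy; have [k kxy] := adj_edge xy.
rewrite (emonE kxy) vdegU kxy !inE [z == x]eq_sym [z == y]eq_sym.
by have [<-|_] := eqVneq x z; rewrite ?[y == x]eq_sym ?(negPf (adj_neq xy)).
Qed.

(* The product of the edges of the walk at the positions of the parity that [b]
   selects: even ones for [true], odd ones for [false]. *)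
Fixpoint altmon (b : bool) (w : seq 'I_n) : 'X_{1..m} :=
  if w is x :: w' then
    if w' is y :: _ then ((if b then emon x y else 0) + altmon (~~ b) w')%MM else 0%MM
  else 0%MM.

Lemma altmon2 b x y w :
  altmon b [:: x, y & w] = ((if b then emon x y else 0) + altmon (~~ b) (y :: w))%MM.
Proof. by []. Qed.

Lemma altmon_cat b w1 x w2 :
  altmon b (w1 ++ x :: w2) =
    (altmon b (rcons w1 x) + altmon (b (+) odd (size w1)) (x :: w2))%MM.
Proof.
elim: w1 b => [|y w1 IHw] b; first by rewrite /= add0m addbF.
case: w1 IHw => [|z w1] IHw; first by rewrite /= addm0 addbT.
rewrite !cat_cons rcons_cons !altmon2 -addmA; congr (_ + _)%MM.
rewrite -!rcons_cons IHw; congr (_ + altmon _ _)%MM.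
by rewrite [size (y :: _)]/= oddS addbN addNb.
Qed.

(** Reversal moves step i to step [size w - 2 - i], which exchanges the two parities exactly when
    [size w] is odd. *)
Lemma altmon_rev b w : altmon b (rev w) = altmon (b (+) odd (size w)) w.
Proof.
elim: w b => [|x w IHw] b //; case: w IHw => [|y w] IHw; first by case: b.
rewrite altmon2 rev_cons rev_cons -!cats1 -catA altmon_cat -rev_cons IHw /= size_rev !negbK.
by rewrite addm0 addmC emonC; case: b; case: odd.
Qed.

(** An occurrence inside the walk lies on exactly one selected step. The two correction terms
    account for an end whose only step is not selected. *)
Lemma vdeg_altmon b x w z : path adj x w ->
  vdeg e (altmon b (x :: w)) z + (~~ b && (x == z)) +
    ((b (+) odd (size w)) && (last x w == z)) = count_mem z (x :: w).
Proof.
elim: w b x => [|y w IHw] b x; first by move=> _; rewrite /= vdeg0 mnm0E; case: b; case: eqP.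
rewrite [path _ _ _]/= => /andP[xy /(IHw (~~ b))].
rewrite altmon2 vdegD mnmDE.
have -> : vdeg e (if b then emon x y else 0%MM) z = b * ((x == z) + (y == z)).
  by case: b; rewrite ?mul1n ?vdeg_emon // vdeg0 mnm0E.
rewrite [last x _]/= [count_mem z (x :: _)]/= [size (y :: w)]/= oddS => /= <-.
by case: b; case: (x == z); case: (y == z); case: odd; case: (_ == z) => /=; lia.
Qed.

Lemma altmon_step b w k : altmon b w k != 0 ->
  exists t1 x y t2, [/\ w = t1 ++ [:: x, y & t2], e k = [set x; y] & odd (size t1) = ~~ b].
Proof.
elim: w b => [|x w IHw] b; first by rewrite mnm0E.
case: w IHw => [|y w] IHw; first by rewrite mnm0E.
rewrite altmon2 mnmDE addn_eq0 negb_and => /orP[|/IHw[t1 [x' [y' [t2 [-> ek odd1]]]]]]; last first.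
  by exists (x :: t1), x', y', t2; split=> //=; rewrite odd1 negbK.
case: b; last by rewrite mnm0E.
rewrite /emon mnm_sumE sum_nat_eq0 => /forallPn[l]; rewrite negb_imply => /andP[/eqP el].
rewrite mnm1E; case: (l =P k) => // lk _; exists [::], x, y, w; split=> //.
by rewrite -lk.
Qed.

Lemma vdeg_gt0 u x : 0 < vdeg e u x -> exists k y, [/\ 0 < u k, adj x y & e k = [set x; y]].
Proof.
rewrite vdegE lt0n sum_nat_eq0 => /forallPn[k] /=.
rewrite muln_eq0 negb_or eqb0 negbK -lt0n => /andP[xk uk].
have [y [z [yz ek]]] := edge_adj k; move: xk; rewrite ek => /set2P[]->.
  by exists k, z.
by exists k, y; rewrite adj_sym setUC.
Qed.

(** Greedy construction: leave [x] along an edge of [v] to some [y]; unless [y] is [z], the degree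
    condition supplies an edge of [u] from [y] to some [t]. Removing both edges restores the
    condition with [t] in place of [x]. *)
Lemma alternating_walk d (u v : 'X_{1..m}) x z : mdeg u < d ->
    (forall y, vdeg e v y = vdeg e u y + (x == y) + (z == y)) ->
  exists r, [/\ sorted adj (x :: rcons r z), ~~ odd (size r),
    (altmon true (x :: rcons r z) <= v)%MM & (altmon false (x :: rcons r z) <= u)%MM].
Proof.
elim: d u v x => // d IHd u v x lt_ud degE.
have [|k [y [vk xy ek]]] := @vdeg_gt0 v x; first by rewrite degE eqxx; lia.
have [yz|nyz] := eqVneq y z.
  exists [::]; split=> //=; first by rewrite -yz xy.
    by rewrite -yz (emonE ek) addm0 lep1mP -lt0n.
  by rewrite addm0; apply/mnm_lepP=> l; rewrite mnm0E.
have le_kv : (U_(k) <= v)%MM by rewrite lep1mP -lt0n.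
have degk w : vdeg e U_(k) w = (x == w) + (y == w) by rewrite -(emonE ek) vdeg_emon.
have [|l [t [ul yt el]]] := @vdeg_gt0 u y.
  have := degE y; rewrite -{1}(submK le_kv) vdegD mnmDE degk eqxx.
  by rewrite (negPf (adj_neq xy)) eq_sym (negPf nyz); lia.
have le_lu : (U_(l) <= u)%MM by rewrite lep1mP -lt0n.
have degl w : vdeg e U_(l) w = (y == w) + (t == w) by rewrite -(emonE el) vdeg_emon.
have [||r [path_r even_r le_v le_u]] := IHd (u - U_(l))%MM (v - U_(k))%MM t.
- by move: lt_ud; rewrite -{1}(submK le_lu) mdegD mdeg1; lia.
- move=> w; have := degE w.
  by rewrite -{1}(submK le_kv) -{1}(submK le_lu) !vdegD !mnmDE degk degl; lia.
exists [:: y, t & r]; rewrite !rcons_cons !altmon2 (emonE ek) (emonE el) add0m /=.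
split; rewrite ?xy ?yt ?negbK //.
  rewrite add0m; apply/mnm_lepP=> w; have := mnm_lepP le_v w; have := mnm_lepP le_kv w.
  by rewrite mnmBE mnmDE /=; lia.
apply/mnm_lepP=> w; have := mnm_lepP le_u w; have := mnm_lepP le_lu w.
by rewrite mnmBE mnmDE /=; lia.
Qed.

(** * Closed walks of a minimal nonstandard monomial *)

Section Minimal.

Variables (u v : 'X_{1..m}) (f : 'I_m) (a : 'I_n).

Definition joins_ends w := e f = [set head a w; last a w].

(* [w] runs once through the edges of [v] (even positions) and of [u] (odd
   positions, and [f], which closes the walk from the last vertex to the first).
   The default [a] is irrelevant: [joins_ends [::]] fails. *)
Definition rep w :=
  [/\ sorted adj w, ~~ odd (size w), joins_ends w,
      (U_(f) + altmon false w)%MM = u & altmon true w = v].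

Lemma closed_walk w : sorted adj w -> ~~ odd (size w) -> joins_ends w ->
  [/\ w != [::], adj (head a w) (last a w),
      forall z, vdeg e (U_(f) + altmon false w)%MM z = count_mem z w
    & forall z, vdeg e (altmon true w) z = count_mem z w].
Proof.
rewrite /joins_ends; case: w => [|x w] /= w_path w_even w_ends.
  by have := card_edge f; rewrite w_ends setUid cards1.
have x_last : adj x (last x w).
  have [y [z [yz fyz]]] := edge_adj f.
  have /setP eq_ends : [set x; last x w] = [set y; z] by rewrite -w_ends.
  have := card_edge f; rewrite w_ends cards2; case: eqP => //= /eqP nx _.
  have := eq_ends x; have := eq_ends (last x w); rewrite !inE !eqxx orbT /=.
  case/esym/orP=> /eqP lE /esym/orP[]/eqP xE; move: nx yz; rewrite lE xE ?eqxx //.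
  by rewrite adj_sym.
split=> // z; rewrite -/(count_mem z (x :: w)).
  rewrite vdegD mnmDE -(vdeg_altmon false z w_path) -(emonE w_ends) vdeg_emon //.
  by rewrite negbK in w_even; rewrite w_even; case: eqP; case: eqP => //=; lia.
by rewrite -(vdeg_altmon true z w_path); rewrite negbK in w_even; rewrite w_even /= !addn0.
Qed.

Lemma rep_count w z : rep w -> vdeg e u z = count_mem z w.
Proof. by case=> w1 w2 w3 <- _; case: (closed_walk w1 w2 w3). Qed.

Lemma rep_rev w : rep w -> rep (rev w).
Proof.
case=> w1 w2 w3 wU wV; split; rewrite ?size_rev ?altmon_rev ?(negPf w2) //.
  by rewrite rev_sorted; apply: sub_sorted w1 => x y; rewrite adj_sym.
rewrite /joins_ends w3 setUC; case: (lastP w) => // w' y.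
by rewrite last_rcons rev_rcons; case: w' => //= x w'; rewrite rev_cons last_rcons.
Qed.

Lemma rep_ends w : rep w ->
  [/\ w != [::], adj (head a w) (last a w) & e f = [set head a w; last a w]].
Proof. by case=> w1 w2 w3 _ _; case: (closed_walk w1 w2 w3). Qed.

Hypothesis u_min : min_nonstd e u.
Hypothesis uv_f : forall k : 'I_m, k < f -> u k = 0 /\ v k = 0.
Hypothesis v_f : v f = 0.

(* Here the minimality of [u] enters: a shorter closed walk through [f] whose
   [u]-edges are taken from [u] would have a smaller nonstandard monomial. *)
Lemma closed_walk_max w : sorted adj w -> ~~ odd (size w) -> joins_ends w ->
    (U_(f) + altmon false w <= u)%MM ->
    (forall k : 'I_m, altmon true w k != 0 -> f < k) ->
  (U_(f) + altmon false w)%MM = u.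
Proof.
move=> w_path w_even w_ends le_u w_gt.
have [_ _ wU wV] := closed_walk w_path w_even w_ends.
have wVU : vdeg e (altmon true w) = vdeg e (U_(f) + altmon false w)%MM.
  by apply/mnmP=> z; rewrite wU wV.
have [_ min_u] := min_nonstdP card_edge _ u_min.
apply/eqP; apply: contraT => /(min_u _ le_u) /negP[]; apply/(nonstdP card_edge).
exists (altmon true w) => //; apply/ltmcP; first exact: (eq_vdeg_mdeg card_edge wVU).
(* Neither product contains an edge before [f], and only the second contains [f]; the first is
   therefore smaller. *)
have V0 (k : 'I_m) : k <= f -> altmon true w k = 0.
  by apply: contraTeq => /w_gt; rewrite ltnNge.
exists f; last by rewrite V0 // mnmDE mnm1E eqxx.
move=> k lt_kf; rewrite V0 1?ltnW //; have := mnm_lepP le_u k.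
by have [-> _] := uv_f lt_kf; lia.
Qed.

Lemma v_gt (k : 'I_m) : v k != 0 -> f < k.
Proof.
rewrite ltnNge leq_eqVlt; apply: contra => /orP[/eqP/val_inj->|/uv_f[_ ->] //].
by rewrite v_f.
Qed.

(** Two visits to [x] cut off a closed segment of [size s2 + 1] edges. If that number were even,
    deleting the segment would keep all parities, and [closed_walk_max] would give the same [u] with
    one visit to [x] fewer. *)
Lemma rep_repeat s1 x s2 s3 : rep (s1 ++ x :: s2 ++ x :: s3) -> ~~ odd (size s2).
Proof.
move=> w_rep; apply/negP=> odd_s2; case: (w_rep) => w1 w2 w3 wU wV.
have path_w : sorted adj (s1 ++ x :: s3).
  by move: w1; rewrite sorted_cat_cons2 sorted_cat_cons => /and3P[-> _ ->].
have altE b : altmon b (s1 ++ x :: s2 ++ x :: s3) =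
    (altmon b (s1 ++ x :: s3) + altmon (b (+) odd (size s1)) (x :: rcons s2 x))%MM.
  rewrite !altmon_cat -cat_cons altmon_cat rcons_cons /= odd_s2 addbF -!addmA.
  by rewrite ![(altmon _ (x :: s3) + _)%MM]addmC.
have even_w : ~~ odd (size (s1 ++ x :: s3)).
  by move: w2; rewrite !size_cat /= size_cat /=; lia.
have ends_w : joins_ends (s1 ++ x :: s3).
  move: w3; rewrite /joins_ends.
  by case: s1 {w_rep w1 w2 wU wV path_w altE even_w} => [|? ?]; rewrite /= ?last_cat /= ?last_cat.
have [_ _ /(_ x) xU _] := closed_walk path_w even_w ends_w.
have eq_u : (U_(f) + altmon false (s1 ++ x :: s3))%MM = u.
  apply: closed_walk_max => // [|k nz]; first by rewrite -wU altE addmA lem_addr.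
  by apply: v_gt; rewrite -wV altE mnmDE; lia.
have := rep_count x w_rep; rewrite -eq_u xU !count_cat /= count_cat /= eqxx; lia.
Qed.

(** The closed segment has an odd number of edges, so reversing it preserves the parity of the
    position of each edge. *)
Lemma rep_reverse s1 x s2 s3 :
  rep (s1 ++ x :: s2 ++ x :: s3) -> rep (s1 ++ x :: rev s2 ++ x :: s3).
Proof.
move=> w_rep; have even_s2 := rep_repeat w_rep; case: (w_rep) => w1 w2 w3 wU wV.
have altE b : altmon b (s1 ++ x :: rev s2 ++ x :: s3) = altmon b (s1 ++ x :: s2 ++ x :: s3).
  rewrite !altmon_cat -!cat_cons !altmon_cat; congr (_ + (_ + _))%MM; last first.
    by rewrite /= size_rev.
  have -> : rcons (x :: rev s2) x = rev (x :: rcons s2 x).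
    by rewrite rev_cons rev_rcons.
  by rewrite altmon_rev /= size_rcons /= negbK (negPf even_s2) addbF ?rcons_cons.
split; rewrite ?altE //.
- move: w1; rewrite !sorted_cat_cons2 => /and3P[-> path_s2 ->].
  rewrite andbT -rcons_cons; have -> : rcons (x :: rev s2) x = rev (x :: rcons s2 x).
    by rewrite rev_cons rev_rcons.
  by rewrite rev_sorted; apply: sub_sorted path_s2 => y z; rewrite adj_sym.
- by move: w2; rewrite !size_cat /= !size_cat size_rev.
- by move: w3; rewrite /joins_ends; case: (s1) => [|? ?]; rewrite /= ?last_cat /= ?last_cat.
Qed.

(** Indices grow as edges get smaller, so the edge on [x] and [y], if there is one, is smaller than
    [f]. *)
Definition late x y := forall k, e k = [set x; y] -> f < k.

(** The chord replaces an odd number of steps beginning at an even position, so it takes the place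
    of an edge of [v]. The shortened walk meets [closed_walk_max], and counting visits shows that
    nothing was skipped. *)
Lemma rep_chord s1 x s2 y s3 : rep (s1 ++ x :: s2 ++ y :: s3) ->
  ~~ odd (size s1) -> ~~ odd (size s2) -> adj x y -> late x y -> s2 = [::].
Proof.
move=> w_rep even_s1 even_s2 xy late_xy; case: (w_rep) => w1 w2 w3 wU wV.
have path_w : sorted adj (s1 ++ x :: y :: s3).
  by move: w1; rewrite sorted_cat_cons2 sorted_cat_cons /= xy => /and3P[-> _ ->].
have even_w : ~~ odd (size (s1 ++ x :: y :: s3)).
  by move: w2; rewrite !size_cat /= size_cat /=; lia.
have ends_w : joins_ends (s1 ++ x :: y :: s3).
  by move: w3; rewrite /joins_ends; case: (s1) => [|? ?]; rewrite /= ?last_cat /= ?last_cat.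
have [_ _ wU' _] := closed_walk path_w even_w ends_w.
have altE b : altmon b (s1 ++ x :: s2 ++ y :: s3) =
    (altmon b (rcons s1 x) + altmon b (rcons (x :: s2) y) + altmon (~~ b) (y :: s3))%MM.
  by rewrite altmon_cat -cat_cons altmon_cat addmA /= (negPf even_s1) (negPf even_s2) addbF addbT.
have altE' b : altmon b (s1 ++ x :: y :: s3) =
    (altmon b (rcons s1 x) + (if b then emon x y else 0) + altmon (~~ b) (y :: s3))%MM.
  by rewrite altmon_cat altmon2 (negPf even_s1) addbF addmA.
have eq_u : (U_(f) + altmon false (s1 ++ x :: y :: s3))%MM = u.
  apply: closed_walk_max => // [|k].
    by apply/mnm_lepP=> k; rewrite -wU altE altE' !mnmDE /= mnm0E; lia.
  have [l lxy] := adj_edge xy; have := altE' true; rewrite (emonE lxy) => ->.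
  rewrite !mnmDE mnm1E.
  case: (l =P k) => [<- _|_ nz]; first exact: late_xy.
  by apply: v_gt; rewrite -wV altE !mnmDE; lia.
case: s2 w_rep {even_s2 w1 w2 w3 wU wV altE} => // z s2 /(rep_count z).
by rewrite -eq_u wU' !count_cat /= count_cat /= eqxx; lia.
Qed.

(** Two consecutive odd closed segments would together form an even one. *)
Lemma rep_triple s1 x s2 s3 s4 : ~ rep (s1 ++ x :: s2 ++ x :: s3 ++ x :: s4).
Proof.
move=> w_rep; have := rep_repeat w_rep.
have := @rep_repeat s1 x (s2 ++ x :: s3) s4; rewrite -catA => /(_ w_rep).
have := @rep_repeat (s1 ++ x :: s2) x s3 s4; rewrite -catA => /(_ w_rep).
by rewrite size_cat /=; lia.
Qed.

Lemma rep_count2 w z : rep w -> count_mem z w <= 2.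
Proof.
move=> w_rep; rewrite leqNgt; apply/negP.
case/count_split=> s1 [r1 [defw /count_split[s2 [r2 [defr1 /count_split[s3 [s4 [defr2 _]]]]]]]].
by rewrite defw defr1 defr2 in w_rep; apply: (@rep_triple s1 z s2 s3 s4).
Qed.

(** Reversing the segment between the two visits to [x] moves one visit to [y] and makes the closed
    segment at [y] even. *)
Lemma rep_cross s1 x s2 y s3 s4 s5 :
  ~ rep (s1 ++ x :: s2 ++ y :: s3 ++ x :: s4 ++ y :: s5).
Proof.
move=> w_rep.
have even_x : ~~ odd (size (s2 ++ y :: s3)).
  by apply: (@rep_repeat s1 x _ (s4 ++ y :: s5)); rewrite -catA.
have even_y : ~~ odd (size (s3 ++ x :: s4)).
  by apply: (@rep_repeat (s1 ++ x :: s2) y _ s5); rewrite -!catA.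
have := @rep_reverse s1 x (s2 ++ y :: s3) (s4 ++ y :: s5).
rewrite -catA => /(_ w_rep); rewrite rev_cat rev_cons cat_rcons -!catA /= => w'_rep.
have := @rep_repeat (s1 ++ x :: rev s3) y (rev s2 ++ x :: s4) s5.
rewrite -!catA /= -?catA => /(_ w'_rep).
by move: even_x even_y; rewrite !size_cat /= size_rev; lia.
Qed.

(* Traversing the closed odd segment backwards changes the parity of the
   position at which [q] is visited. *)
Lemma rep_parity c q s1 y s4 s5 : rep (s1 ++ y :: s4 ++ y :: s5) -> q \in y :: s4 ->
  exists t1 t2, [/\ rep (s1 ++ t1 ++ q :: t2 ++ s5), odd (size (s1 ++ t1)) = c
    & q != y -> t1 != [::] /\ t2 != [::]].
Proof.
move=> w_rep; have even_s4 := rep_repeat w_rep; rewrite inE => /orP[/eqP->|].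
  (* The two visits to [y] have positions of opposite parity, so one of them is suitable. *)
  have [<-|/eqP nc] := eqVneq (odd (size s1)) c.
    by exists [::], (rcons s4 y); rewrite /= cats0 eqxx cat_rcons.
  exists (y :: s4), [::]; rewrite /= eqxx; split=> //.
  by rewrite size_cat /=; lia.
move=> q_s4; case/splitPr: q_s4 w_rep even_s4 => t1 t2 w_rep even_s4.
have [<-|/eqP nc] := eqVneq (odd (size (s1 ++ y :: t1))) c.
  exists (y :: t1), (rcons t2 y); split=> //; last by case: t2 {w_rep even_s4}.
  by rewrite /= cat_rcons; rewrite -catA in w_rep.
exists (y :: rev t2), (rcons (rev t1) y); split=> //; last by case: (rev t1).
  by have := rep_reverse w_rep; rewrite rev_cat rev_cons cat_rcons /= -!catA /= cat_rcons.
by move: nc even_s4; rewrite !size_cat /= size_rev; lia.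
Qed.

(** If the two were equal, [rep_parity] could place both visits at even positions, and the closed
    segment between them would be even. *)
Lemma rep_disjoint_mem s1 x s2 s3 y s4 s5 p q :
  rep (s1 ++ x :: s2 ++ x :: s3 ++ y :: s4 ++ y :: s5) ->
  p \in s2 -> q \in y :: s4 -> p != q.
Proof.
move=> w_rep p_s2 q_s4; apply/eqP=> pq; rewrite -{q}pq in q_s4.
have p_s2' : p \in x :: s2 by rewrite inE p_s2 orbT.
have [t1 [t2 [w1_rep odd1 _]]] := rep_parity false w_rep p_s2'.
have := @rep_parity false p (s1 ++ t1 ++ p :: t2 ++ s3) y s4 s5.
rewrite -!catA /= -!catA => /(_ w1_rep q_s4)[t3 [t4 [w2_rep]]] odd2 _.
have w3_rep : rep ((s1 ++ t1) ++ p :: (t2 ++ s3 ++ t3) ++ p :: t4 ++ s5).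
  by move: w2_rep; rewrite -!catA /= -?catA.
move: (rep_repeat w3_rep).
by move: odd1 odd2; rewrite !size_cat /= !size_cat; lia.
Qed.

(** With [p] moved to an even and [q] to an odd position, the edge between them is a chord forbidden
    by [rep_chord]; as [p] differs from [x], something does lie between them. *)
Lemma rep_disjoint_adj s1 x s2 s3 y s4 s5 p q :
  rep (s1 ++ x :: s2 ++ x :: s3 ++ y :: s4 ++ y :: s5) ->
  p \in s2 -> q \in y :: s4 -> late p q -> ~~ adj p q.
Proof.
move=> w_rep p_s2 q_s4 late_pq; apply/negP=> pq.
have p_s2' : p \in x :: s2 by rewrite inE p_s2 orbT.
have px : p != x.
  apply/eqP=> px; rewrite px in p_s2; case/splitPr: p_s2 w_rep => c d.
  by rewrite -catA /=; apply: rep_triple.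
have [t1 [t2 [w1_rep odd1 /(_ px)[_ t2n]]]] := rep_parity false w_rep p_s2'.
have := @rep_parity true q (s1 ++ t1 ++ p :: t2 ++ s3) y s4 s5.
rewrite -!catA /= -!catA => /(_ w1_rep q_s4)[t3 [t4 [w2_rep]]] odd2 _.
have w3_rep : rep ((s1 ++ t1) ++ p :: (t2 ++ s3 ++ t3) ++ q :: t4 ++ s5).
  by move: w2_rep; rewrite -!catA /= -?catA.
suff : t2 ++ s3 ++ t3 = [::] by case: (t2) t2n.
apply: (rep_chord w3_rep) => //; first by rewrite odd1.
by move: odd1 odd2; rewrite !size_cat /= !size_cat; lia.
Qed.

(** * Consequences of gap-freeness: the possible shapes of the walk *)

Hypothesis adj_gap : gap_free adj.
Variable b : 'I_n.
Hypothesis f_b : b \in e f.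
Hypothesis b_max : forall c, c \in e f -> vrank c <= vrank b.

Lemma late_of_rank x y z : z \in [set x; y] -> vrank b < vrank z -> late x y.
Proof.
move=> zxy lt_bz k kxy; apply: (@lt_edge f k z); first by rewrite kxy.
by move=> c /b_max le_cb; apply: leq_ltn_trans lt_bz.
Qed.

Lemma rep_edge_ge t1 x y t2 k : rep (t1 ++ [:: x, y & t2]) -> e k = [set x; y] -> f <= k.
Proof.
move=> [_ _ _ wU wV] kxy; rewrite leqNgt; apply/negP=> /uv_f [uk0 vk0].
have alt_k c : c = odd (size t1) -> altmon (~~ c) (t1 ++ [:: x, y & t2]) k != 0.
  by move=> ->; rewrite altmon_cat addNb addbb altmon2 (emonE kxy) !mnmDE mnm1E eqxx; lia.
case: (boolP (odd (size t1))) alt_k => _ alt_k.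
  have := alt_k _ erefl; have := congr1 (fun w : 'X_{1..m} => w k) wU.
  by rewrite /= mnmDE uk0; lia.
by have := alt_k _ erefl; rewrite /= wV vk0.
Qed.

(* The vertices of smaller rank than [b] are independent along the walk, so they cannot
   alternate with the others around an odd closed segment. *)
Lemma rep_high_edge s1 y s4 s5 : rep (s1 ++ y :: s4 ++ y :: s5) -> b \notin y :: s4 ->
  exists q1 q2, [/\ q1 \in y :: s4, q2 \in y :: s4, adj q1 q2,
    vrank b < vrank q1 & vrank b < vrank q2].
Proof.
move=> w_rep b_s4; have even_s4 := rep_repeat w_rep.
pose P x := vrank b < vrank x.
(* The segment returns to [y] after [size s4 + 1] steps, an odd number, so [P] cannot change at
   every step. *)
have not_alt : ~~ path (fun p q => P p != P q) y (rcons s4 y).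
  apply/negP=> alt; have := alternating_last alt; rewrite last_rcons size_rcons /= (negPf even_s4).
  by case: (P y).
have [t1 [q1 [q2 [t2 [defw /negPn/eqP eqP12]]]]] := path_break not_alt.
have mem_s4 q : q \in t1 ++ [:: q1, q2 & t2] -> q \in y :: s4.
  by rewrite -defw !inE mem_rcons inE orbA orbb.
have q1_s4 : q1 \in y :: s4 by apply: mem_s4; rewrite mem_cat !inE eqxx orbT.
have q2_s4 : q2 \in y :: s4 by apply: mem_s4; rewrite mem_cat !inE eqxx !orbT.
have w'_rep : rep ((s1 ++ t1) ++ [:: q1, q2 & t2 ++ s5]).
  have := w_rep; have -> : s1 ++ y :: s4 ++ y :: s5 = s1 ++ (y :: rcons s4 y) ++ s5.
    by rewrite /= cat_rcons.
  by rewrite defw -!catA.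
have q12 : adj q1 q2 by case: w'_rep; rewrite sorted_cat_cons /= => /and3P[].
exists q1, q2; case: (boolP (P q1)) eqP12 => Pq1 Pq2; first by split; rewrite // -/(P q2) -Pq2.
have low q : q \in y :: s4 -> ~~ P q -> vrank q < vrank b.
  move=> q_s4; rewrite -leqNgt leq_eqVlt => /orP[/eqP rq|//].
  have qb : q = b by apply: (@perm_inj _ (s^-1)%g); apply: val_inj.
  by rewrite -qb q_s4 in b_s4.
have [k kq] := adj_edge q12.
have := rep_edge_ge w'_rep kq; rewrite leqNgt => /negP[].
apply: (@lt_edge k f b) => // c; rewrite kq => /set2P[]->; apply: low => //.
by rewrite -Pq2.
Qed.



(** Otherwise the second segment has an edge with both variables below x_b. Gap-freeness joins it to
    an edge inside [s2], and [rep_disjoint_adj] forbids every such connection. *)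
Lemma rep_disjoint_high s1 x s2 s3 y s4 s5 :
  rep (s1 ++ x :: s2 ++ x :: s3 ++ y :: s4 ++ y :: s5) -> b \in y :: s4.
Proof.
move=> w_rep; apply: contraT => b_s4.
have even_s2 := rep_repeat w_rep.
have := @rep_high_edge (s1 ++ x :: s2 ++ x :: s3) y s4 s5.
rewrite -!catA /= -!catA /= => /(_ w_rep b_s4)[q1 [q2 [q1_s4 q2_s4 q12 bq1 bq2]]].
case: s2 even_s2 w_rep => [|p1 [|p2 s2]] //= _ w_rep.
  by case: w_rep; rewrite sorted_cat_cons /= adj_irr andbF.
have p12 : adj p1 p2.
  by case: w_rep; rewrite sorted_cat_cons /= => /and4P[].
have p1_s2 : p1 \in [:: p1, p2 & s2] by rewrite inE eqxx.
have p2_s2 : p2 \in [:: p1, p2 & s2] by rewrite !inE eqxx orbT.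
have dj p q := @rep_disjoint_mem s1 x [:: p1, p2 & s2] s3 y s4 s5 p q w_rep.
have na p q := @rep_disjoint_adj s1 x [:: p1, p2 & s2] s3 y s4 s5 p q w_rep.
have late1 p : late p q1 by apply: late_of_rank bq1; rewrite !inE eqxx orbT.
have late2 p : late p q2 by apply: late_of_rank bq2; rewrite !inE eqxx orbT.
have := adj_gap p12 q12; rewrite /= !inE !negb_or (adj_neq p12) (adj_neq q12).
rewrite !dj // => /(_ isT).
by rewrite !(negPf (na _ _ _ _ _)).
Qed.

(** By reversal [b] lies on both segments. Being also an end of the walk, it would be visited three
    times. *)
Lemma rep_disjoint s1 x s2 s3 y s4 s5 :
  ~ rep (s1 ++ x :: s2 ++ x :: s3 ++ y :: s4 ++ y :: s5).
Proof.
move=> w_rep; have b_s4 := rep_disjoint_high w_rep.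
have b_s2 : b \in x :: s2.
  have := @rep_disjoint_high (rev s5) y (rev s4) (rev s3) x (rev s2) (rev s1).
  rewrite !inE mem_rev; apply; move: (rep_rev w_rep).
  rewrite !rev_cat !rev_cons !rev_cat !rev_cons !rev_cat !rev_cons.
  by rewrite !rev_cat !rev_cons -!cats1 -!catA.
have [_ _ fE] := rep_ends w_rep.
have := rep_count2 b w_rep; rewrite !(count_cat, =^~ cat_cons).
move: b_s2 b_s4; rewrite -!has_pred1 !has_count.
move: f_b; rewrite fE => /set2P[]->.
  case: s1 {w_rep fE} => [|z s1] /=; rewrite eqxx; lia.
case/lastP: s5 {w_rep fE} => [|s5 z]; do ?rewrite last_cat /=.
  by rewrite eqxx; lia.
by rewrite last_rcons -cats1 count_cat /= eqxx; lia.
Qed.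

(** A first vertex on the inner segment would create a triple visit or a crossing. *)
Lemma rep_nested_mem_head s1 x s2 y s3 s4 s5 :
  rep (s1 ++ x :: s2 ++ y :: s3 ++ y :: s4 ++ x :: s5) ->
  head a (s1 ++ x :: s2 ++ y :: s3 ++ y :: s4 ++ x :: s5) \notin y :: s3.
Proof.
case: s1 => [|h s1] w_rep; rewrite /= inE; apply/negP=> /orP[/eqP xy|x_s3].
- by rewrite xy in w_rep; apply: (@rep_triple [::] y s2 s3 (s4 ++ y :: s5)).
- case/splitPr: x_s3 w_rep => c d; rewrite -catA /= => w_rep.
  apply: (@rep_triple [::] x (s2 ++ y :: c) (d ++ y :: s4) s5).
  by rewrite /= -!catA /= -?catA.
- rewrite xy in w_rep; apply: (@rep_triple [::] y (s1 ++ x :: s2) s3 (s4 ++ x :: s5)).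
  by rewrite /= -!catA /= -?catA.
case/splitPr: x_s3 w_rep => c d; rewrite -catA /= => w_rep.
apply: (@rep_cross [::] h (s1 ++ x :: s2) y c d (s4 ++ x :: s5)).
by rewrite /= -!catA /= -?catA.
Qed.

(** Once [q] is moved to an odd position, [rep_chord] makes it the successor of [h], which forces
    [q] to be [y] and empties [s1] and [s2]. Reversing the outer segment empties [s4] in the same
    way. *)
Lemma rep_nested_head s1 x s2 y s3 s4 s5 q :
  rep (s1 ++ x :: s2 ++ y :: s3 ++ y :: s4 ++ x :: s5) -> q \in y :: s3 ->
  let h := head a (s1 ++ x :: s2) in adj h q -> late h q ->
  [/\ s1 = [::], s2 = [::] & s4 = [::]].
Proof.
move=> w_rep q_s3 h hq late_hq.
have := @rep_parity true q (s1 ++ x :: s2) y s3 (s4 ++ x :: s5).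
rewrite -!catA /= => /(_ w_rep q_s3)[t1 [t2 [w1_rep odd1 t12]]].
have [s1_nil s2_nil t1_nil] : [/\ s1 = [::], s2 = [::] & t1 = [::]].
  have [r defr] : exists r, s1 ++ x :: s2 ++ t1 = h :: r.
    by rewrite /h; case: (s1) => [|z s1'] /=; [exists (s2 ++ t1) | exists (s1' ++ x :: s2 ++ t1)].
  have w2_rep : rep ([::] ++ h :: r ++ q :: (t2 ++ s4 ++ x :: s5)).
    by rewrite /= -cat_cons -defr; move: w1_rep; rewrite -!catA /= -?catA.
  have r_nil : r = [::].
    apply: (rep_chord w2_rep) => //; move: odd1.
    by rewrite -catA /= defr /= => ->.
  by move: defr; rewrite r_nil; case: (s1) (s2) (t1) => [|? [|? ?]] [|? ?] [|? ?].
have qy : q = y by apply/eqP; apply: contraT => /t12[]; rewrite t1_nil.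
split=> //; rewrite s1_nil s2_nil /= in w_rep h hq late_hq; rewrite qy in hq late_hq.
have even_s3 : ~~ odd (size s3).
  exact: (@rep_repeat [:: x] y s3 (s4 ++ x :: s5)).
have w2_rep : rep ([::] ++ x :: (y :: s3 ++ y :: s4) ++ x :: s5) by rewrite /= -!catA.
have := rep_repeat w2_rep; have := rep_reverse w2_rep.
rewrite rev_cons rev_cat rev_cons cat_rcons cat_rcons -!catA /= => w3_rep odd34.
have : rev s4 = [::].
  apply: (@rep_chord [::] x _ y (rev s3 ++ y :: x :: s5)) => //; rewrite size_rev.
  by move: even_s3 odd34; rewrite /= size_cat /=; lia.
by move/(congr1 rev); rewrite revK.
Qed.

(** The ends of [f] avoid the inner segment, so this segment has an edge with both variables below
    x_b. Gap-freeness joins that edge to an end of [f], and [rep_nested_head] applies to the walk or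
    to its reversal. *)
Lemma rep_nested s1 x s2 y s3 s4 s5 :
  rep (s1 ++ x :: s2 ++ y :: s3 ++ y :: s4 ++ x :: s5) ->
  [/\ s1 = [::] \/ s5 = [::], s2 = [::] & s4 = [::]].
Proof.
move=> w_rep; set w := _ ++ _ in w_rep.
have w'_rep : rep (rev s5 ++ x :: rev s4 ++ y :: rev s3 ++ y :: rev s2 ++ x :: rev s1).
  have := rep_rev w_rep.
  rewrite !rev_cat !rev_cons !rev_cat !rev_cons !rev_cat !rev_cons.
  by rewrite !rev_cat !rev_cons -!cats1 -!catA.
have revE : rev w = rev s5 ++ x :: rev s4 ++ y :: rev s3 ++ y :: rev s2 ++ x :: rev s1.
  rewrite !rev_cat !rev_cons !rev_cat !rev_cons !rev_cat !rev_cons.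
  by rewrite !rev_cat !rev_cons -!cats1 -!catA.
have last_w : last a w = head a (rev w).
  by case: (lastP w) => // w' z; rewrite last_rcons rev_rcons.
have [_ ends_adj fE] := rep_ends w_rep.
have b_s3 : b \notin y :: s3.
  have := f_b; rewrite fE => /set2P[]->; first exact: rep_nested_mem_head.
  by have := rep_nested_mem_head w'_rep; rewrite -revE -last_w !inE mem_rev.
have w2_rep : rep ((s1 ++ x :: s2) ++ y :: s3 ++ y :: (s4 ++ x :: s5)).
  by rewrite -!catA.
have [q1 [q2 [q1_s3 q2_s3 q12 bq1 bq2]]] := rep_high_edge w2_rep b_s3.
have out c q : c \in e f -> vrank b < vrank q -> c != q.
  by move=> /b_max le_cb; apply: contraTneq => <-; rewrite -leqNgt.
have f_h : head a w \in e f by rewrite fE !inE eqxx.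
have f_l : last a w \in e f by rewrite fE !inE eqxx orbT.
have := adj_gap ends_adj q12; rewrite /= !inE !negb_or (adj_neq ends_adj) (adj_neq q12).
rewrite !(out _ _ f_h) // !(out _ _ f_l) // => /(_ isT).
have late_h q p : vrank b < vrank q -> late p q.
  by apply: late_of_rank; rewrite !inE eqxx orbT.
have case_h q : q \in y :: s3 -> vrank b < vrank q -> adj (head a w) q ->
    [/\ s1 = [::] \/ s5 = [::], s2 = [::] & s4 = [::]].
  have -> : head a w = head a (s1 ++ x :: s2) by rewrite /w; case: (s1).
  move=> q_s3 bq hq; have [|-> -> ->] := rep_nested_head w_rep q_s3 hq; first exact: late_h.
  by split; first left.
have case_l q : q \in y :: s3 -> vrank b < vrank q -> adj (last a w) q ->
    [/\ s1 = [::] \/ s5 = [::], s2 = [::] & s4 = [::]].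
  rewrite last_w; have -> : head a (rev w) = head a (rev s5 ++ x :: rev s4).
    by rewrite revE; case: (rev s5).
  move=> q_s3 bq hq.
  have q_s3' : q \in y :: rev s3 by rewrite !inE mem_rev in q_s3 *.
  have [|/(congr1 rev) s5_nil /(congr1 rev) s4_nil /(congr1 rev) s2_nil] :=
    rep_nested_head w'_rep q_s3' hq.
    exact: late_h.
  by rewrite !revK in s5_nil s4_nil s2_nil; split=> //; right.
by case/or4P=> h; first [exact: case_h h | exact: case_l h].
Qed.

(** Any further repetition is a triple visit, a crossing, a pair of disjoint odd segments, or a
    nested pair violating [rep_nested]. *)
Lemma rep_double_uniq x y s3 s5 :
  rep (x :: y :: s3 ++ y :: x :: s5) -> uniq (x :: y :: s3 ++ s5).
Proof.
move=> w_rep; have path_w : sorted adj (x :: y :: s3 ++ y :: x :: s5) by case: w_rep.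
have xy : x != y by apply: adj_neq; case/andP: path_w.
rewrite /= inE !mem_cat !negb_or xy cat_uniq /=; apply/and4P; split.
- apply/andP; split; apply/negP=> x_s.
    case/splitPr: x_s w_rep => c d; rewrite -catA /= => w_rep.
    apply: (@rep_triple [::] x (y :: c) (d ++ [:: y]) s5).
    by rewrite /=; do ?rewrite -catA /=.
  case/splitPr: x_s w_rep => c d w_rep.
  apply: (@rep_triple [::] x (y :: s3 ++ [:: y]) c d).
  by rewrite /=; do ?rewrite -catA /=.
- apply/andP; split; apply/negP=> y_s.
    case/splitPr: y_s w_rep => c d; rewrite -catA /= => w_rep.
    by apply: (@rep_triple [:: x] y c d (x :: s5)).
  case/splitPr: y_s w_rep => c d w_rep.
  by apply: (@rep_triple [:: x] y s3 (x :: c) d).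
- apply: contraT => /dup_split[c [z [d [g defs3]]]]; rewrite defs3 in w_rep.
  have w'_rep : rep ([::] ++ x :: (y :: c) ++ z :: d ++ z :: (g ++ [:: y]) ++ x :: s5).
    by have := w_rep; rewrite /=; do ?rewrite -catA /=.
  by case: (rep_nested w'_rep).
apply/andP; split; last first.
  apply: contraT => /dup_split[c [z [d [g defs5]]]]; rewrite defs5 in w_rep.
  exfalso; apply: (@rep_disjoint [::] x (y :: s3 ++ [:: y]) c z d g).
  by rewrite /=; do ?rewrite -catA /=.
apply/hasPn=> z z_s5; apply/negP=> z_s3.
case/splitPr: z_s5 w_rep => c d; case/splitPr: z_s3 => c' d'; rewrite -catA /= => w_rep.
apply: (@rep_cross [::] x (y :: c') z (d' ++ [:: y]) c d).
by rewrite /=; do ?rewrite -catA /=.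
Qed.

(** The cases are an even cycle, two odd cycles sharing [x], and two odd cycles joined by a doubled
    edge. The last may only be reached for the reversed walk, so it asserts [rep] anew. *)
Lemma rep_shape w : rep w ->
  [\/ uniq w,
      exists s1 x s2 s3, w = s1 ++ x :: s2 ++ x :: s3 /\ uniq (s1 ++ x :: s2 ++ s3)
    | exists x y s3 s5, rep (x :: y :: s3 ++ y :: x :: s5) /\ uniq (x :: y :: s3 ++ s5)].
Proof.
move=> w_rep; have [|/dup_split[s1 [x [s2 [s3 defw]]]]] := orP (orbN (uniq w)).
  by constructor 1.
rewrite defw in w_rep *.
have nested t1 z t2 z' t3 t4 t5 :
    rep (t1 ++ z :: t2 ++ z' :: t3 ++ z' :: t4 ++ z :: t5) ->
  [\/ uniq (s1 ++ x :: s2 ++ x :: s3),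
      exists r1 y r2 r3, s1 ++ x :: s2 ++ x :: s3 = r1 ++ y :: r2 ++ y :: r3
        /\ uniq (r1 ++ y :: r2 ++ r3)
    | exists x y s3 s5, rep (x :: y :: s3 ++ y :: x :: s5) /\ uniq (x :: y :: s3 ++ s5)].
  move=> t_rep; have [t15 t2n t4n] := rep_nested t_rep.
  rewrite t2n t4n /= in t_rep; constructor 3; case: t15 => tn; rewrite tn /= in t_rep.
    by exists z, z', t3, t5; split=> //; apply: rep_double_uniq.
  have t'_rep := rep_rev t_rep.
  rewrite !rev_cat !rev_cons !rev_cat !rev_cons -!cats1 -!catA /= in t'_rep.
  by exists z, z', (rev t3), (rev t1); split=> //; apply: rep_double_uniq.
have [un|] := orP (orbN (uniq (s1 ++ x :: s2 ++ s3))); first by constructor 2; exists s1, x, s2, s3.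
move: nested; set goal := or3 _ _ _; move: goal => goal nested.
rewrite cat_uniq /= cat_uniq mem_cat has_cat !negb_or.
have -> : uniq s1.
  apply: contraT => /dup_split[c [z [d [g defs]]]]; rewrite defs in w_rep; exfalso.
  apply: (@rep_disjoint c z d g x s2 s3).
  by have := w_rep; rewrite /=; do ?rewrite -catA /=.
have -> : uniq s3.
  apply: contraT => /dup_split[c [z [d [g defs]]]]; rewrite defs in w_rep; exfalso.
  exact: (@rep_disjoint s1 x s2 c z d g).
have -> : x \notin s1.
  apply/negP=> x_s; case/splitPr: x_s w_rep => c d w_rep.
  apply: (@rep_triple c x d s2 s3).
  by have := w_rep; rewrite /=; do ?rewrite -catA /=.
have -> : x \notin s2.
  apply/negP=> x_s; case/splitPr: x_s w_rep => c d w_rep.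
  apply: (@rep_triple s1 x c d s3).
  by have := w_rep; rewrite /=; do ?rewrite -catA /=.
have -> : x \notin s3.
  apply/negP=> x_s; case/splitPr: x_s w_rep => c d w_rep.
  exact: (@rep_triple s1 x s2 c d).
have -> : ~~ has (mem s1) s2.
  apply/hasPn=> z z_s2; apply/negP=> z_s1; case/splitPr: z_s1 w_rep => c d.
  case/splitPr: z_s2 => c' d' w_rep; apply: (@rep_cross c z d x c' d' s3).
  by have := w_rep; rewrite /=; do ?rewrite -catA /=.
have -> : ~~ has (mem s2) s3.
  apply/hasPn=> z z_s3; apply/negP=> z_s2; case/splitPr: z_s2 w_rep => c d.
  case/splitPr: z_s3 => c' d' w_rep; apply: (@rep_cross s1 x c z d c' d').
  by have := w_rep; rewrite /=; do ?rewrite -catA /=.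
rewrite /= !andbT negb_and negbK => /orP[/hasP[z z_s3 z_s1]|/dup_split[c [z [d [g defs]]]]].
  have {}z_s1 : z \in s1 by [].
  case/splitPr: z_s1 w_rep => c d; case/splitPr: z_s3 => c' d' w_rep.
  apply: (nested c z d x s2 c' d').
  by have := w_rep; rewrite /=; do ?rewrite -catA /=.
rewrite defs in w_rep; apply: (nested s1 x c z d g s3).
by have := w_rep; rewrite /=; do ?rewrite -catA /=.
Qed.

(** A second [f] would be an odd step between the two ends of the walk. Run from the last vertex to
    the first, it closes an even segment; run the other way, it separates two disjoint odd
    segments. *)
Lemma rep_multiplicity1 w : rep w -> altmon false w f = 0.
Proof.
move=> w_rep; apply/eqP; apply: contraT => /altmon_step[t1 [x [y [t2 [defw fxy odd1]]]]].
have [_ _ fE] := rep_ends w_rep; rewrite defw in w_rep fE *.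
case: t1 odd1 w_rep fE {defw} => // h t1 /= odd1 w_rep fE.
have xy : adj x y by case: w_rep; rewrite -cat_cons sorted_cat_cons => /andP[_ /andP[]].
have /setP eq_f : [set h; last h (t1 ++ [:: x, y & t2])] = [set x; y] by rewrite -fE.
have := eq_f x; have := eq_f y; rewrite !inE !eqxx orbT /= => /orP[]/eqP yE /orP[]/eqP xE.
- by have := adj_neq xy; rewrite (etrans xE (esym yE)) eqxx.
- rewrite yE in w_rep.
  have w'_rep : rep ([::] ++ h :: (t1 ++ [:: x]) ++ h :: t2) by rewrite /= -catA.
  by have := rep_repeat w'_rep; rewrite size_cat /= addn1 /= odd1.
- case/lastP: t2 w_rep xE yE {fE eq_f} => [|t2 z] w_rep xE yE.
    by case: w_rep => _; rewrite /= size_cat /=; lia.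
  rewrite last_cat /= last_rcons in yE; exfalso; rewrite -cats1 xE yE in w_rep.
  by apply: (@rep_disjoint [::] h t1 [::] z t2 [::]).
by have := adj_neq xy; rewrite (etrans xE (esym yE)) eqxx.
Qed.

(** As [c] vanishes at [f], it is carried by the open walk. Peeling from the ends leaves nothing or
    one odd cycle, on which [carried_odd_cycle] finishes. *)
Lemma rep_kernel w (c : 'I_m -> int) k : rep w ->
  (forall x, (\sum_k c k *+ (x \in e k) = 0)%R) ->
  (forall k, c k != 0%R -> u k != 0 \/ v k != 0) -> c f = 0%R -> c k = 0%R.
Proof.
move=> w_rep c_ker c_uv c_f.
have cw w' : rep w' -> carried e c w'.
  case=> _ _ _ wU wV l cl.
  suff [b' /altmon_step[t1 [x [y [t2 [-> el _]]]]]] : exists b', altmon b' w' l != 0.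
    by exists (x, y) => //; rewrite steps_cat mem_cat steps_cons mem_head orbT.
  case: (c_uv l cl) => [|vl]; last by exists true; rewrite wV.
  rewrite -wU mnmDE mnm1E; case: (f =P l) => [fl|_ nz]; last by exists false.
  by rewrite -fl c_f eqxx in cl.
have peel := @carried_peel _ _ e edge_inj c c_ker.
have odd_cycle := @carried_odd_cycle _ _ e card_edge edge_inj c c_ker.
case: (rep_shape w_rep) => [uniq_w|[s1 [x [s2 [s3 [defw uniq_w]]]]]|].
- exact: (carried_uniq edge_inj c_ker _ uniq_w (cw _ w_rep)).
- have even_s2 : ~~ odd (size s2) by rewrite defw in w_rep; apply: rep_repeat w_rep.
  have {}cw := cw _ w_rep; rewrite {}defw in cw.
  have [uniq1 no12 uniq23] :
    [/\ uniq s1, ~~ has (mem s1) (x :: s2 ++ x :: s3) & uniq (x :: s2 ++ s3)].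
    move: uniq_w; rewrite cat_uniq => /and3P[-> no12 ->]; split=> //.
    by move: no12; rewrite /= !has_cat /= !negb_or; case/and3P=> -> -> ->.
  have := carried_rev (peel _ _ uniq1 no12 cw).
  rewrite rev_cons rev_cat rev_cons -!cats1 -!catA /=.
  move: uniq23; rewrite -cat_cons cat_uniq => /and3P[uniq2 no23 uniq3] {}cw.
  have {}cw : carried e c (x :: rcons (rev s2) x).
    rewrite -cats1; apply: peel cw; first by rewrite rev_uniq.
    apply: contra no23 => /hasP[z z2 z3]; apply/hasP; exists z; first by rewrite -mem_rev.
    by move: z2; rewrite !inE mem_cat mem_rev inE; case: (z == x); rewrite ?orbF.
  apply: odd_cycle cw; last by rewrite size_rev.
  by rewrite /= mem_rev rev_uniq.
case=> x [y [s3 [s5 [w'_rep uniq_w]]]]; have {}cw := carried_rev (cw _ w'_rep).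
have even_s3 : ~~ odd (size s3) by apply: (@rep_repeat [:: x] y s3 (x :: s5)).
move: uniq_w; rewrite -!cat_cons cat_uniq => /and3P[uniq3 no35 uniq5].
(* The doubled edge is listed twice; dropping its final copy leaves a single visit to [x], which can
   then be peeled. *)
have {}cw : carried e c ([:: x] ++ y :: rcons (rev s3) y).
  move=> l cl; suff: carried e c ([:: x; y] ++ rev s3 ++ [:: y; x]).
    case/(_ l cl)=> p; rewrite !cat_cons !cat0s steps_cons inE => /orP[/eqP->|] el.
      by exists (x, y) => //; rewrite steps_cons mem_head.
    case: p el => p1 p2; rewrite -cat_cons steps_cat mem_cat => /orP[p_s el|].
      by exists (p1, p2) => //; rewrite steps_cons inE -rcons_cons p_s orbT.
    rewrite -[steps _]/[:: (y, x)] mem_seq1 => /eqP[-> ->] el.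
    by exists (x, y); rewrite ?steps_cons ?mem_head // el setUC.
  move: cw; rewrite !rev_cons rev_cat !rev_cons -!cats1 -!catA; apply: peel.
    by rewrite rev_uniq.
  apply: contra no35 => /hasP[z z3 z5]; apply/hasP; exists z; first by rewrite -mem_rev.
  move: z3; rewrite /= !inE mem_cat mem_rev !inE.
  by case: (z == x); case: (z == y); rewrite ?orbT ?orbF.
have xy3 : x \notin y :: rcons (rev s3) y.
  move: uniq3 => /= /andP[]; by rewrite !inE mem_rcons inE mem_rev orbA orbb.
have {}cw : carried e c (y :: rcons (rev s3) y).
  apply: peel cw => //; apply/hasPn=> z z_s; rewrite /= inE.
  by apply: contraNneq xy3 => <-.
apply: odd_cycle cw; last by rewrite size_rev.
by move: uniq3; rewrite /= mem_rev rev_uniq => /andP[].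
Qed.

End Minimal.
Lemma le_vdeg_eq (u v : 'X_{1..m}) : (u <= v)%MM -> vdeg e u = vdeg e v -> u = v.
Proof.
move=> uv /(eq_vdeg_mdeg card_edge) deg_uv; have := congr1 (@mdeg m) (submK uv).
rewrite mdegD deg_uv => /eqP; rewrite -{2}[mdeg v]add0n eqn_add2r mdeg_eq0 => /eqP vu.
by rewrite -(submK uv) vu add0m.
Qed.

Lemma exists_max_rank k : exists2 b, b \in e k & forall c, c \in e k -> vrank c <= vrank b.
Proof.
have [x [y [_ ->]]] := edge_adj k; have [le_xy|lt_yx] := leqP (vrank x) (vrank y).
  by exists y; rewrite ?set22 // => c /set2P[]->.
by exists x; rewrite ?set21 // => c /set2P[]-> //; apply: ltnW.
Qed.

(** The exponents at [f] serve irreducibility, the degree bound serves finiteness of the basis, and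
    the kernel statement serves minimality of the support. The bound holds because the walk visits
    each vertex at most twice. *)
Theorem min_nonstd_binomial (u v : 'X_{1..m}) : gap_free adj ->
    min_nonstd e u -> vdeg e v = vdeg e u -> (v < u)%O ->
  exists f, [/\ u f = 1, v f = 0, mdeg u <= n
    & forall c : 'I_m -> int, (forall x, (\sum_k c k *+ (x \in e k) = 0)%R) ->
      (forall k, c k != 0%R -> u k != 0 \/ v k != 0) -> c f = 0%R -> forall k, c k = 0%R].
Proof.
move=> adj_gap u_min vu lt_vu.
have cop := min_nonstd_coprime card_edge u_min vu lt_vu.
(* At the first index where the exponents differ; by coprimality both vanish before it. *)
have [f eq_f lt_f] := ltmcP (eq_vdeg_mdeg card_edge vu) lt_vu.
have uv_f (k : 'I_m) : k < f -> u k = 0 /\ v k = 0.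
  by move=> /eq_f vuk; case: (cop k) => k0; [rewrite vuk k0|rewrite -vuk k0].
have v_f : v f = 0 by case: (cop f) => // uf0; rewrite uf0 in lt_f.
have [b f_b b_max] := exists_max_rank f.
have [x [z [xz fE]]] := edge_adj f.
have le_fu : (U_(f) <= u)%MM by rewrite lep1mP -lt0n; apply: leq_trans lt_f.
have [||r [path_w even_r le_v le_u]] := @alternating_walk (mdeg u) (u - U_(f))%MM v x z.
- by rewrite -{2}(submK le_fu) mdegD mdeg1; lia.
- move=> y; rewrite vu -{1}(submK le_fu) vdegD mnmDE -(emonE fE) vdeg_emon //; lia.
set w := x :: rcons r z in path_w le_v le_u.
have even_w : ~~ odd (size w) by rewrite /= size_rcons /= negbK.
have ends_w : joins_ends f x w by rewrite /joins_ends /= last_rcons.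
have wU : (U_(f) + altmon false w)%MM = u.
  apply: (closed_walk_max u_min uv_f v_f path_w even_w ends_w).
    apply/mnm_lepP=> k; rewrite -(submK le_fu) !mnmDE addnC leq_add2r.
    exact: (mnm_lepP le_u).
  move=> k nz; apply: (v_gt uv_f v_f); have := mnm_lepP le_v k; lia.
have [_ _ degU degV] := closed_walk path_w even_w ends_w.
(* This product divides [v] and has the same vertex degrees. *)
have wV : altmon true w = v.
  apply: le_vdeg_eq le_v _; apply/mnmP=> y; rewrite degV vu -wU degU //.
have w_rep : rep u v f x w by split.
have rep1 := rep_multiplicity1 u_min uv_f v_f adj_gap f_b b_max w_rep.
exists f; split=> //.
- by rewrite -wU mnmDE mnm1E eqxx rep1.
- rewrite -(leq_pmul2l (isT : 0 < 2)) -(mdeg_vdeg card_edge) mdegE.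
  apply: (@leq_trans (\sum_(i < n) 2)); last by rewrite sum_nat_const card_ord mulnC.
  apply: leq_sum => y _.
  rewrite (rep_count y w_rep).
  exact: (rep_count2 u_min uv_f v_f y w_rep).
move=> c c_ker c_uv c_f k.
exact: (rep_kernel u_min uv_f v_f adj_gap f_b b_max k w_rep c_ker c_uv c_f).
Qed.

End Edges.

Local Open Scope ring_scope.

(** * Monomial and binomial ideals *)

Section IdealSpan.

Variable R : comNzRingType.
Implicit Types (S T : R -> Prop) (f g : R).

Lemma ideal_span_gen S f : S f -> ideal_span S f.
Proof.
move=> Sf; exists [:: (1, f)]; last by rewrite big_seq1 mul1r.
by move=> c; rewrite inE => /eqP->.
Qed.

Lemma ideal_spanMl S f g : ideal_span S f -> ideal_span S (g * f).
Proof.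
case=> cs cs_S ->; exists [seq (g * c.1, c.2) | c <- cs].
  by move=> _ /mapP[c /cs_S Sc ->].
by rewrite big_map big_distrr; apply: eq_bigr => c _; rewrite /= mulrA.
Qed.

Lemma ideal_spanD S f g : ideal_span S f -> ideal_span S g -> ideal_span S (f + g).
Proof.
case=> cs cs_S -> [ds ds_S ->]; exists (cs ++ ds); last by rewrite big_cat.
by move=> c; rewrite mem_cat => /orP[/cs_S|/ds_S].
Qed.

Lemma ideal_span0 S : ideal_span S 0.
Proof. by exists [::]; rewrite ?big_nil. Qed.

Lemma ideal_span_sum S (I : eqType) (r : seq I) (F : I -> R) :
  (forall i, i \in r -> ideal_span S (F i)) -> ideal_span S (\sum_(i <- r) F i).
Proof.
move=> SF; rewrite big_seq; apply: (big_ind (ideal_span S)) => //.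
  exact: ideal_span0.
by move=> f g; apply: ideal_spanD.
Qed.

Lemma ideal_span_sub S T f :
  (forall g, S g -> ideal_span T g) -> ideal_span S f -> ideal_span T f.
Proof.
move=> ST [cs cs_S ->]; apply: ideal_span_sum => c /cs_S Sc.
by apply: ideal_spanMl; apply: ST.
Qed.

End IdealSpan.

Lemma coef_linear_poly (R : nzRingType) (a b : R) :
  (a%:P * 'X - b%:P)`_0 = - b /\ (a%:P * 'X - b%:P)`_1 = a.
Proof. by rewrite !coefB !coefMX !coefC /= sub0r subr0. Qed.

Lemma size_linear_poly (R : nzRingType) (a b : R) :
  a != 0 -> size (a%:P * 'X - b%:P) = 2.
Proof.
move=> a0; rewrite -[LHS]/(size (a%:P * 'X + - b%:P)) -polyCN.
by rewrite size_MXaddC polyC_eq0 (negPf a0) size_polyC a0.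
Qed.

Lemma size_mul_eq2 (R : idomainType) (p q : {poly R}) :
  size (p * q) = 2 -> size p = 1%N \/ size q = 1%N.
Proof.
have [->|p0] := eqVneq p 0; first by rewrite mul0r size_poly0.
have [->|q0] := eqVneq q 0; first by rewrite mulr0 size_poly0.
have := p0; have := q0; rewrite size_mul // -!size_poly_gt0; lia.
Qed.

Section Monomials.

Variables (K : fieldType) (m : nat).
Implicit Types (f g p q : {mpoly K[m]}) (u v w : 'X_{1..m}).

Lemma msupp_mulX_le p u w : w \in msupp (p * 'X_[u]) -> (u <= w)%MM.
Proof.
rewrite (perm_mem (msuppMX _ _)) => /mapP[v _ ->]; exact: lem_addr.
Qed.

Lemma lead_ideal_monomial (lt : rel 'X_{1..m}) S w : lead_ideal lt S ('X_[w] : {mpoly K[m]}) ->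
  exists f u, [/\ S f, is_lead lt f u & (u <= w)%MM].
Proof.
case=> cs cs_S /(congr1 (mcoeff w)); rewrite mcoeffX eqxx raddf_sum /=.
have [/hasP[c c_cs cw] _|/hasPn cs0] := boolP (has (fun c => (c.1 * c.2)@_w != 0) cs).
  have [f [u [Sf fu c2]]] := cs_S _ c_cs; exists f, u; split=> //.
  by apply: (@msupp_mulX_le c.1); rewrite -c2 mcoeff_msupp.
rewrite big_seq big1 => [/eqP|c /cs0/negPn/eqP //].
by rewrite oner_eq0.
Qed.

Lemma lead_ideal_multiple (lt : rel 'X_{1..m}) (S : {mpoly K[m]} -> Prop) f u w :
  S f -> is_lead lt f u -> (u <= w)%MM -> lead_ideal lt S 'X_[w].
Proof.
move=> Sf fu uw; rewrite -(submK uw) mpolyXD; apply: ideal_spanMl.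
by apply: ideal_span_gen; exists f, u.
Qed.

Lemma msupp_binomial u v w : u != v ->
  (w \in msupp ('X_[u] - 'X_[v] : {mpoly K[m]})) = (w == u) || (w == v).
Proof.
move=> nuv; rewrite mcoeff_msupp mcoeffB !mcoeffX ![_ == w]eq_sym.
have [->|nwu] := eqVneq w u; first by rewrite (negPf nuv) subr0 oner_eq0.
by have [_|_] := eqVneq w v; rewrite sub0r oppr_eq0 ?oner_eq0 ?eqxx.
Qed.

Lemma is_lead_binomial (lt : rel 'X_{1..m}) u v : u != v -> lt v u ->
  is_lead lt ('X_[u] - 'X_[v] : {mpoly K[m]}) u.
Proof.
move=> nuv lt_vu; rewrite /is_lead msupp_binomial // eqxx /=.
by apply/allP=> w; rewrite msupp_binomial // => /orP[/eqP->|/eqP->]; rewrite ?eqxx ?lt_vu ?orbT.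
Qed.

(** The coefficients stay in the full ring, so evaluation at ['X_k] inverts the map. *)
Definition as_poly_in (k : 'I_m) : {mpoly K[m]} -> {poly {mpoly K[m]}} :=
  mmap (polyC \o @mpolyC m K) (fun i => if i == k then 'X else ('X_i)%:P).

Lemma as_poly_inM k : {morph as_poly_in k : p q / p * q}.
Proof. exact: rmorphM. Qed.

Lemma as_poly_inB k : {morph as_poly_in k : p q / p - q}.
Proof. exact: rmorphB. Qed.

Lemma as_poly_inK k p : (as_poly_in k p).['X_k] = p.
Proof.
rewrite /as_poly_in /mmap horner_sum [RHS]mpolyE; apply: eq_bigr => w _.
rewrite hornerM /= hornerC mul_mpolyC /mmap1 horner_prod (mpolyXE_id _ w); congr (_ *: _).
by apply: eq_bigr => i _; rewrite horner_exp; case: eqP => [->|_]; rewrite ?hornerX ?hornerC.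
Qed.

Lemma as_poly_inX k u : as_poly_in k 'X_[u] = ('X_[u - U_(k) *+ u k])%:P * 'X^(u k).
Proof.
rewrite /as_poly_in mmapX /mmap1 (bigD1 k) //= eqxx mulrC; congr (_ * _).
rewrite (mpolyXE_id _ (u - U_(k) *+ u k)%MM) [in RHS](bigD1 k) //= mnmBE mulmnE mnm1E eqxx.
rewrite mul1n subnn expr0 mul1r.
rewrite rmorph_prod; apply: eq_bigr => i nik.
by rewrite (negPf nik) mnmBE mulmnE mnm1E eq_sym (negPf nik) mul0n subn0 rmorphXn.
Qed.

(** The leading monomial of [p] divides both [u] and [v], hence is 1; as [mlead] respects the
    degree, [p] is constant. *)
Lemma dvd_coprime_monomials_unit p q r u v c : c != 0 ->
    (forall i, u i = 0 \/ v i = 0)%N -> p * q = 'X_[u] -> p * r = c *: 'X_[v] ->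
  p \is a GRing.unit.
Proof.
move=> c0 cop pq pr.
have X0 w : 'X_[w] != 0 :> {mpoly K[m]}.
  by apply/eqP=> /(congr1 (mcoeff w)); rewrite mcoeffX eqxx mcoeff0 => /eqP; rewrite oner_eq0.
have : p * q != 0 by rewrite pq X0.
rewrite mulf_eq0 negb_or => /andP[p0 q0].
have : p * r != 0 by rewrite pr scaler_eq0 negb_or c0 X0.
rewrite mulf_eq0 negb_or => /andP[_ r0].
have lead_v : mlead (c *: 'X_[v] : {mpoly K[m]}) = v.
  by rewrite mleadZ_proper mleadXm // mcoeffX eqxx mulr1.
have := mleadM p0 q0; rewrite pq mleadXm => uE.
have := mleadM p0 r0; rewrite pr lead_v => vE.
have p_deg0 : mlead p = 0%MM.
  apply/mnmP=> i; rewrite mnm0E; case: (cop i); rewrite ?uE ?vE mnmDE => /eqP;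
    by rewrite addn_eq0 => /andP[/eqP-> _].
have /msize_poly1P[d d0 ->] : msize p == 1%N by rewrite -mlead_deg // p_deg0 mdeg0.
by rewrite rmorph_unit // unitfE.
Qed.

(** The binomial is linear in the variable [k], so one factor has degree 0 in it and divides both
    coefficients, which are coprime monomials up to sign. *)
Lemma irreducible_binomial u v k : u k = 1%N -> v k = 0%N ->
    (forall i, u i = 0 \/ v i = 0)%N ->
  irreducible_elt ('X_[u] - 'X_[v] : {mpoly K[m]}).
Proof.
move=> uk vk cop.
have nuv : u != v by apply/eqP=> uv; rewrite uv vk in uk.
have X0 w : 'X_[w] != 0 :> {mpoly K[m]}.
  by apply/eqP=> /(congr1 (mcoeff w)); rewrite mcoeffX eqxx mcoeff0 => /eqP; rewrite oner_eq0.
set b := _ - _.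
have ub : u \in msupp b by rewrite msupp_binomial ?eqxx.
have bE : as_poly_in k b = 'X_[u - U_(k)]%:P * 'X - 'X_[v]%:P.
  rewrite as_poly_inB !as_poly_inX uk vk expr1 expr0 mulr1.
  by rewrite mulm1n mulm0n subm0.
have size_b : size (as_poly_in k b) = 2.
  by rewrite bE size_linear_poly.
have b0 : b != 0 by apply: contraTneq ub => ->; rewrite mcoeff_msupp mcoeff0 eqxx.
have unit_factor p q : b = p * q -> size (as_poly_in k p) = 1%N -> p \is a GRing.unit.
  move=> bpq /eqP/size_poly1P[c c0 pc].
  have {}pc : as_poly_in k p = p%:P by rewrite -[p in RHS](as_poly_inK k) pc hornerC.
  have := bE; rewrite bpq as_poly_inM pc => pqE.
  have coefE i : p * (as_poly_in k q)`_i = ('X_[u - U_(k)]%:P * 'X - 'X_[v]%:P)`_i.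
    by rewrite -pqE coefCM.
  have [b0E b1E] := coef_linear_poly ('X_[u - U_(k)] : {mpoly K[m]}) 'X_[v].
  have p1 := etrans (coefE 1) b1E; have p0 := etrans (coefE 0) b0E.
  rewrite -scaleN1r in p0.
  apply: dvd_coprime_monomials_unit p1 p0; first by rewrite oppr_eq0 oner_eq0.
  by move=> i; rewrite mnmBE; case: (cop i) => ->; [left; lia | right].
split=> // [|p q bpq].
  apply/negP=> /andP[/eqP bC _].
  have : u \in msupp b by [].
  by rewrite bC msuppC; case: ifP => // _; rewrite inE => /eqP u0; rewrite u0 mnm0E in uk.
rewrite bpq as_poly_inM in size_b.
case/size_mul_eq2: size_b => [sp|sq]; first by left; apply: (unit_factor p q).
by right; apply: (unit_factor q p); rewrite 1?mulrC.
Qed.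

End Monomials.

(** * The toric ideal and its reduced Groebner basis *)

Section Toric.

Variables (K : fieldType) (n m : nat) (e : 'I_m -> {set 'I_n}).
Hypothesis e2 : forall k, #|e k| = 2%N.
Implicit Types (f g : {mpoly K[m]}) (u v w : 'X_{1..m}).

Notation I := (@toric_ideal K n m e).
Notation lex := (@lex_lt m).

Lemma toric_monomial u :
  'X_[u] \mPo [tuple 'X_[K, edge_mnm (e k)] | k < m] = 'X_[vdeg e u].
Proof.
rewrite comp_mpolyX; under eq_bigr do rewrite tnth_mktuple mpolyXn.
rewrite mprodXE; congr 'X_[_]; apply/mnmP=> x.
rewrite mnm_sumE vdegE; apply: eq_bigr => k _.
by rewrite mulmnE edge_mnmE.
Qed.

Lemma toricD f g : I f -> I g -> I (f + g).
Proof. by rewrite /toric_ideal comp_mpolyD => -> ->; rewrite addr0. Qed.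

Lemma toricN f : I f -> I (- f).
Proof. by rewrite /toric_ideal comp_mpolyN => ->; rewrite oppr0. Qed.

Lemma toricB f g : I f -> I g -> I (f - g).
Proof. by move=> If /toricN; apply: toricD. Qed.

Lemma toric_span (S : {mpoly K[m]} -> Prop) f :
  (forall g, S g -> I g) -> ideal_span S f -> I f.
Proof.
move=> SI [cs cs_S ->]; rewrite big_seq; apply: (big_ind I).
- by rewrite /toric_ideal comp_mpoly0.
- exact: toricD.
move=> c /cs_S/SI; rewrite /toric_ideal [in X in _ -> X]rmorphM /= => ->.
by rewrite mulr0.
Qed.

Lemma toric_binomial u v : I ('X_[u] - 'X_[v]) <-> vdeg e u = vdeg e v.
Proof.
rewrite /toric_ideal comp_mpolyB !toric_monomial; split=> [/eqP|->]; last exact: subrr.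
rewrite subr_eq0 => /eqP/(congr1 (mcoeff (vdeg e u))); rewrite !mcoeffX eqxx.
by case: eqVneq => // _ /eqP; rewrite oner_eq0.
Qed.

(** The image of [u] has to be cancelled by another term with the same image. *)
Lemma toric_partner f u : I f -> u \in msupp f ->
  exists v, [/\ v \in msupp f, v != u & vdeg e v = vdeg e u].
Proof.
move=> If uf; have [/hasP[v vf /andP[nvu /eqP vu]]|/hasPn none] :=
  boolP (has (fun v => (v != u) && (vdeg e v == vdeg e u)) (msupp f)); first by exists v.
have := uf; rewrite mcoeff_msupp => /eqP[].
have := congr1 (mcoeff (vdeg e u)) If; rewrite mcoeff0 comp_mpolyEX.
rewrite raddf_sum (bigD1_seq u) ?msupp_uniq //= big_seq_cond big1.
  by rewrite mcoeffZ toric_monomial mcoeffX eqxx mulr1 addr0.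
move=> v /andP[/none]; rewrite negb_and negbK => /orP[->//|nvu] _.
by rewrite mcoeffZ toric_monomial mcoeffX (negPf nvu) mulr0.
Qed.

Lemma toric_lead f u : I f -> is_lead lex f u -> nonstd e u.
Proof.
move=> If /andP[uf /allP lead_u]; have [v [vf nvu vu]] := toric_partner If uf.
apply/(nonstdP e2); exists v => //; have := lead_u v vf; rewrite (negPf nvu) /=.
by rewrite lex_lt_ltmc // (eq_vdeg_mdeg e2 vu).
Qed.

Lemma toric_std0 f : I f -> (forall u, u \in msupp f -> ~~ nonstd e u) -> f = 0.
Proof.
move=> If f_std; apply/eqP; rewrite -msupp_eq0.
case supp_f : (msupp f) => [//|u us]; have uf : u \in msupp f by rewrite supp_f mem_head.
have [v [vf nvu vu]] := toric_partner If uf; case/eqP: nvu.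
by apply: (std_inj e2 vu); apply: f_std.
Qed.

Definition std_binomial u : {mpoly K[m]} := 'X_[u] - 'X_[nform e u].

Lemma nform_neq u : nonstd e u -> u != nform e u.
Proof. by move/(nform_lt e2)=> lt_u; apply: contraTneq lt_u => <-; rewrite ltxx. Qed.

Lemma toric_std_binomial u : I (std_binomial u).
Proof. by apply/toric_binomial; rewrite vdeg_nform. Qed.

Lemma lead_std_binomial u : nonstd e u -> is_lead lex (std_binomial u) u.
Proof.
move=> nu; apply: is_lead_binomial; first exact: nform_neq.
by rewrite lex_lt_ltmc ?nform_lt //; apply: (eq_vdeg_mdeg e2); rewrite vdeg_nform.
Qed.

Lemma lead_ideal_toric w : lead_ideal lex I 'X_[w] <-> nonstd e w.
Proof.
split=> [/lead_ideal_monomial[f [u [If fu uw]]]|nw].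
  exact: nonstd_le uw (toric_lead If fu).
apply: (lead_ideal_multiple (toric_std_binomial w) (lead_std_binomial nw)).
exact: lepm_refl.
Qed.

Lemma is_lead_uniq f u w : is_lead lex f u -> is_lead lex f w -> u = w.
Proof.
move=> /andP[uf /allP lead_u] /andP[wf /allP lead_w].
have := lead_u w wf; have := lead_w u uf; rewrite eq_sym; case: eqP => [//|_] /=.
case/existsP=> k /andP[lt_k /forallP eq_k] /existsP[l /andP[lt_l /forallP eq_l]].
case: (ltngtP k l) => [lt_kl|lt_lk|/val_inj kl].
- by have := implyP (eq_l k) lt_kl; move: lt_k => /[swap] /eqP->; rewrite ltnn.
- by have := implyP (eq_k l) lt_lk; move: lt_l => /[swap] /eqP->; rewrite ltnn.
by rewrite kl in lt_k; have := ltn_trans lt_k lt_l; rewrite ltnn.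
Qed.

(** A leading monomial that is not minimal would make [g] redundant. Then [g - std_binomial u] lies
    in the ideal and has only standard monomials, so it is 0 by [toric_std0]. *)
Lemma reduced_basis_elt (gs : seq {mpoly K[m]}) g :
  reduced_groebner_basis lex I gs -> g \in gs ->
  exists2 u, min_nonstd e u & g = std_binomial u.
Proof.
case=> [[gsI leadE] monic irred red] g_gs.
have [u gu g_u] := monic g g_gs; have Ig := gsI g g_gs.
have nu := toric_lead Ig gu.
have min_u : min_nonstd e u.
  have [v vu min_v] := exists_min_nonstd nu.
  have [<-//|nvu] := eqVneq v u; exfalso.
  have nv : nonstd e v by case/andP: min_v.
  apply: (irred g g_gs) => f; split; last first.
    move=> gs_f; apply/leadE; apply: ideal_span_sub gs_f => q [h [w [/andP[h_gs _] hw ->]]].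
    by apply: ideal_span_gen; exists h, w.
  move/leadE; apply: ideal_span_sub => q [h [w [h_gs hw ->]]].
  have [hg|nhg] := eqVneq h g; last first.
    by apply: ideal_span_gen; exists h, w; rewrite h_gs.
  rewrite hg in hw; rewrite -(is_lead_uniq gu hw).
  have /leadE/lead_ideal_monomial[h' [w' [h'_gs hw' w'v]]] : lead_ideal lex I 'X_[v].
    by apply/lead_ideal_toric.
  apply: (lead_ideal_multiple _ hw'); last exact: lepm_trans vu.
  rewrite h'_gs; apply: contraNneq nvu => h'g; rewrite h'g in hw'.
  rewrite -(is_lead_uniq gu hw') in w'v; apply/eqP/mnmP=> i; apply/eqP.
  by rewrite eqn_leq (mnm_lepP vu) (mnm_lepP w'v).
exists u => //; apply/eqP; rewrite -subr_eq0; apply/eqP/toric_std0.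
  exact: toricB Ig (toric_std_binomial u).
move=> w w_supp.
have [wu|nwu] := eqVneq w u.
  move: w_supp; rewrite wu mcoeff_msupp mcoeffB g_u mcoeffB !mcoeffX eqxx.
  by rewrite [nform e u == u]eq_sym (negPf (nform_neq nu)) subr0 subrr eqxx.
have := msuppB_le w_supp; rewrite mem_cat /std_binomial msupp_binomial ?nform_neq //.
rewrite (negPf nwu) /= => /orP[wg|/eqP->]; last exact: nform_std.
apply/negP=> /lead_ideal_toric; apply: red g_gs wg _.
by apply/negP=> /(is_lead_uniq gu) uw; rewrite uw eqxx in nwu.
Qed.

Variable d : nat.
Hypothesis min_deg : forall u, min_nonstd e u -> (mdeg u <= d)%N.

(** The bound [d] makes the minimal nonstandard monomials a finite enumeration; it is later taken to
    be [n]. *)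
Definition std_basis : seq {mpoly K[m]} :=
  [seq std_binomial (bmnm b) |
     b <- [seq b <- enum {: 'X_{1..m < d.+1}} | min_nonstd e (bmnm b)]].

Lemma std_basisP g :
  reflect (exists2 u, min_nonstd e u & g = std_binomial u) (g \in std_basis).
Proof.
apply: (iffP mapP) => [[u]|[u mu ->]].
  by rewrite mem_filter => /andP[mu _] ->; exists (bmnm u).
have ub : (mdeg u < d.+1)%N by rewrite ltnS min_deg.
by exists (BMultinom ub); rewrite // mem_filter /= mu mem_enum.
Qed.

Lemma std_basis_reduced : reduced_groebner_basis lex I std_basis.
Proof.
have gsI g : g \in std_basis -> I g.
  by case/std_basisP=> u _ ->; apply: toric_std_binomial.
split=> [|g|g|g u].
- split=> // f; split; apply: ideal_span_sub => q [h [w [Ih hw ->]]].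
    have [u uw mu] := exists_min_nonstd (toric_lead Ih hw).
    apply: (lead_ideal_multiple _ (lead_std_binomial _) uw); last by case/andP: mu.
    by apply/std_basisP; exists u.
  by apply: ideal_span_gen; exists h, w; split=> //; apply: gsI.
- case/std_basisP=> u /andP[nu _] ->; exists u; first exact: lead_std_binomial.
  by rewrite mcoeffB !mcoeffX eqxx [nform e u == u]eq_sym (negPf (nform_neq nu)) subr0.
- case/std_basisP=> u mu -> leadE; have nu : nonstd e u by case/andP: mu.
  have /leadE/lead_ideal_monomial[h [w [/andP[h_gs nh] hw wu]]] : lead_ideal lex I 'X_[u].
    exact/lead_ideal_toric.
  have nw := toric_lead (gsI h h_gs) hw.
  have wuE : w = u.
    have [_ min_u] := min_nonstdP e2 _ mu; apply/eqP; apply: contraT => /(min_u w wu).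
    by rewrite nw.
  case/std_basisP: h_gs nh hw => v mv -> nuv; case/andP=> w_supp _.
  have nv : nonstd e v by case/andP: mv.
  move: w_supp; rewrite msupp_binomial ?nform_neq //.
  case/orP=> /eqP wE; last by move: nw; rewrite wE (negPf (nform_std e2 v)).
  by case/eqP: nuv; rewrite -wE wuE.
case/std_basisP=> v /andP[nv _] ->; rewrite msupp_binomial ?nform_neq //.
case/orP=> /eqP -> lead_u; first by case/negP: lead_u; apply: lead_std_binomial.
by move/lead_ideal_toric; rewrite (negPf (nform_std e2 v)).
Qed.

(** One reduction step by a minimal divisor [v] leaves the binomial of a smaller [w] in the same
    fiber, with the same normal form. *)
Lemma std_binomial_span u :
  ideal_span (fun g => exists2 v, min_nonstd e v & g = std_binomial v) (std_binomial u).
Proof.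
elim/(well_founded_ind (@ltom_wf m)): u => u IHu.
have [nu|su] := boolP (nonstd e u); last first.
  rewrite /std_binomial (std_inj e2 (_ : vdeg e (nform e u) = vdeg e u)) ?vdeg_nform ?nform_std //.
  by rewrite subrr; apply: ideal_span0.
have [v vu mv] := exists_min_nonstd nu.
have nv : nonstd e v by case/andP: mv.
set w := (u - v + nform e v)%MM.
have wu : vdeg e w = vdeg e u by rewrite vdegD vdeg_nform // -vdegD submK.
have lt_wu : (w < u)%O by rewrite -[ltRHS](submK vu) ltmc_add2r nform_lt.
have -> : std_binomial u = 'X_[u - v] * std_binomial v + std_binomial w.
  rewrite /std_binomial mulrBr -!mpolyXD submK // -/w (eq_nform e2 wu) addrA subrK //.
apply: ideal_spanD (IHu w lt_wu); apply: ideal_spanMl.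
by apply: ideal_span_gen; exists v.
Qed.

(** Replacing every monomial of [f] by its normal form yields an element of the ideal with only
    standard monomials, that is 0. *)
Lemma toric_spanned f : I f ->
  ideal_span (fun g => exists2 v, min_nonstd e v & g = std_binomial v) f.
Proof.
move=> If; have -> : f = \sum_(u <- msupp f) (f@_u)%:MP * std_binomial u.
  apply/eqP; rewrite -subr_eq0; apply/eqP; apply: toric_std0.
    apply: toricB => //; apply: (@toric_span I) => //; apply: ideal_span_sum => u _.
    by apply: ideal_spanMl; apply: ideal_span_gen; apply: toric_std_binomial.
  have -> : f - \sum_(u <- msupp f) (f@_u)%:MP * std_binomial u =
      \sum_(u <- msupp f) f@_u *: 'X_[nform e u].
    rewrite {1}[f]mpolyE -sumrB; apply: eq_bigr => u _.
    by rewrite /std_binomial mul_mpolyC scalerBr opprB addrC subrK.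
  move=> w; rewrite mcoeff_msupp raddf_sum /=; apply: contraNN => nw.
  rewrite big1 // => u _; rewrite mcoeffZ mcoeffX; case: eqVneq => [uw|_]; last by rewrite mulr0.
  by rewrite -uw (negPf (nform_std e2 u)) in nw.
apply: ideal_span_sum => u _; apply: ideal_spanMl; exact: std_binomial_span.
Qed.

End Toric.

(** * Circuits and the final assembly *)

Lemma mem_supp_vars (K : fieldType) m (u v : 'X_{1..m}) k : u != v ->
  (k \in supp_vars ('X_[u] - 'X_[v] : {mpoly K[m]})) = (u k != 0%N) || (v k != 0%N).
Proof.
move=> nuv; rewrite inE; apply/hasP/orP => [[w]|].
  by rewrite msupp_binomial // => /orP[]/eqP->; [left | right].
by case=> nz; [exists u | exists v]; rewrite // msupp_binomial // eqxx ?orbT.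
Qed.

Lemma vdeg_kernel n m (e : 'I_m -> {set 'I_n}) (u v : 'X_{1..m}) x :
  vdeg e u = vdeg e v -> \sum_k ((u k)%:Z - (v k)%:Z) *+ (x \in e k) = 0.
Proof.
move=> uv; under eq_bigr do rewrite mulrnBl; rewrite sumrB; apply/eqP; rewrite subr_eq0.
have sumE (w : 'X_{1..m}) : \sum_k (w k)%:Z *+ (x \in e k) = (vdeg e w x)%:Z.
  rewrite vdegE -natz natr_sum; apply: eq_bigr => k _.
  by case: (x \in e k); rewrite ?mul1n ?mul0n ?natz.
by rewrite !sumE uv.
Qed.

(** The exponent difference of a binomial supported inside that of [u] is an integer multiple of the
    one of [u]: it is zero or has full support. *)
Lemma circuit_std_binomial (K : fieldType) (n m : nat) (adj : rel 'I_n)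
    (s : 'S_n) (e : 'I_m -> {set 'I_n}) (u : 'X_{1..m}) :
    ssrbool.symmetric adj -> irreflexive adj -> gap_free adj ->
    decreasing_edge_list adj s e -> min_nonstd e u ->
  circuit (@toric_ideal K n m e) (std_binomial K e u).
Proof.
move=> adj_sym adj_irr adj_gap e_dec mu.
have e2 := card_edge adj_irr e_dec; have nu : nonstd e u by case/andP: mu.
have vu := vdeg_nform e2 u; have lt_vu := nform_lt e2 nu.
have cop := min_nonstd_coprime e2 mu vu lt_vu.
have [f [uf vf _ ker0]] := min_nonstd_binomial adj_sym adj_irr e_dec adj_gap mu vu lt_vu.
have nuv := nform_neq e2 nu.
split.
- exact: toric_std_binomial.
- by exists u, (nform e u).
- exact: irreducible_binomial uf vf cop.
case=> _ [/[swap] [[u' [v' [nuv' ->]]]] /toric_binomial uv' /properP[sub [l]]].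
rewrite !mem_supp_vars // => l_uv /negP[].
pose d k := (u' k)%:Z - (v' k)%:Z; pose g k := (u k)%:Z - (nform e u k)%:Z.
have supp_sub k : u' k != 0%N \/ v' k != 0%N -> u k != 0%N \/ nform e u k != 0%N.
  by move=> /orP kuv'; apply/orP; have := subsetP sub k; rewrite !mem_supp_vars //; apply.
(* Since [g f] is 1, the two sides agree at [f], and a kernel vector on this support is determined
   by its value there. *)
have dE k : d k = d f * g k.
  apply/eqP; rewrite -subr_eq0; apply/eqP.
  apply: (ker0 (fun k => d k - d f * g k)) => [x|{}k nz|].
  - under eq_bigr do rewrite mulrnBl -mulrnAr; rewrite sumrB -mulr_sumr.
    by rewrite !vdeg_kernel // mulr0 subr0.
  - apply/orP; apply: contraNT nz; rewrite negb_or !negbK => /andP[/eqP uk /eqP vk].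
    have /andP[/eqP u'k /eqP v'k] : (u' k == 0%N) && (v' k == 0%N).
      by apply: contraT; rewrite negb_and => /orP/supp_sub; rewrite uk vk; case.
    by rewrite /d /g u'k v'k uk vk !subrr mulr0 subrr.
  by rewrite /g uf vf subr0 mulr1 subrr.
have df : d f != 0.
  apply: contraNneq nuv' => df0; apply/eqP/mnmP=> k.
  by have := dE k; rewrite df0 mul0r /d; lia.
have gl : g l != 0 by move: l_uv; rewrite /g; case: (cop l) => ->; lia.
have : d l != 0 by rewrite dE mulf_neq0.
by rewrite /d; lia.
Qed.

Theorem mainTheorem4 (K : fieldType) (n m : nat) (adj : rel 'I_n)
    (adj_sym : ssrbool.symmetric adj) (adj_irr : irreflexive adj)
    (adj_iso : no_isolated_vertex adj) (adj_gap : gap_free adj)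
    (s : 'S_n) (e : 'I_m -> {set 'I_n})
    (e_dec : decreasing_edge_list adj s e) :
  (exists gs : seq {mpoly K[m]},
     reduced_groebner_basis (@lex_lt m) (toric_ideal e) gs) /\
  (forall gs : seq {mpoly K[m]},
     reduced_groebner_basis (@lex_lt m) (toric_ideal e) gs ->
     forall g, g \in gs -> circuit (toric_ideal e) g) /\
  (forall f : {mpoly K[m]},
     toric_ideal e f <-> ideal_span (circuit (toric_ideal e)) f).
Proof.
have e2 := card_edge adj_irr e_dec.
have circ u : min_nonstd e u -> circuit (@toric_ideal K n m e) (std_binomial K e u).
  exact: circuit_std_binomial adj_sym adj_irr adj_gap e_dec.
split; [|split=> [gs gs_red g g_gs|f]].
- exists (std_basis K e n); apply: std_basis_reduced => // u mu.
  have nu : nonstd e u by case/andP: mu.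
  have [f [_ _ deg_u _]] := min_nonstd_binomial adj_sym adj_irr e_dec adj_gap mu
    (vdeg_nform e2 u) (nform_lt e2 nu).
  exact: deg_u.
- by have [u mu ->] := reduced_basis_elt e2 gs_red g_gs; apply: circ.
split=> [If|]; last by apply: toric_span => g [].
apply: ideal_span_sub (toric_spanned e2 If) => g [u mu ->].
by apply: ideal_span_gen; apply: circ.
Qed.
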